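(* For each $\epsilon>0$ there exists $\delta=\delta(\epsilon)>0$ such that whenever $\beta>0$ and $\Delta\in(0,1)$ satisfy $(\beta J)\Delta^2\ge1/\delta$ and $(\beta J)\Delta^3\le\delta$, then $$\limsup_{L\to\infty}\bigl|F^{(\Delta)}_{L,\beta}(\theta^\star)-F(\theta^\star)\bigr|\le\epsilon\qquad\text{for all }\theta^\star\in[0,2\pi).$$
   Context: On the torus $\mathbb T_L=\mathbb Z^3/(L\mathbb Z)^3$, write spins as angles $\boldsymbol\theta=(\theta_{\boldsymbol r})$, $\boldsymbol S_{\boldsymbol r}=(\cos\theta_{\boldsymbol r},\sin\theta_{\boldsymbol r})$, and let $\mathscr H_L(\boldsymbol\theta)=\frac J2\sum_{\boldsymbol r\in\mathbb T_L}\bigl[(\cos\theta_{\boldsymbol r}-\cos\theta_{\boldsymbol r+\hat{\mathrm e}_1})^2+(\cos(\theta_{\boldsymbol r}-\tfrac{2\pi}3)-\cos(\theta_{\boldsymbol r+\hat{\mathrm e}_2}-\tfrac{2\pi}3))^2+(\cos(\theta_{\boldsymbol r}+\tfrac{2\pi}3)-\cos(\theta_{\boldsymbol r+\hat{\mathrm e}_3}+\tfrac{2\pi}3))^2\bigr]$, $J>0$. Let $\chi_{\Delta,L}(\boldsymbol\theta)$ be the indicator that $|\theta_{\boldsymbol r}-\theta^\star|<\Delta$ (difference mod $2\pi$) for all $\boldsymbol r\in\mathbb T_L$. Define $F^{(\Delta)}_{L,\beta}(\theta^\star)=-\frac12\log\frac{\beta J}{2\pi}-\frac1{L^3}\log\int_{[0,2\pi)^{\mathbb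 T_L}}e^{-\beta\mathscr H_L(\boldsymbol\theta)}\chi_{\Delta,L}(\boldsymbol\theta)\prod_{\boldsymbol r}d\theta_{\boldsymbol r}$. With $q_1=\sin^2\theta^\star$, $q_2=\sin^2(\theta^\star-\tfrac{2\pi}3)$, $q_3=\sin^2(\theta^\star+\tfrac{2\pi}3)$, define the spin-wave free energy $F(\theta^\star)=\frac12\int_{[-\pi,\pi]^3}\frac{d\boldsymbol k}{(2\pi)^3}\log\Bigl\{\sum_{\alpha=1}^3q_\alpha|1-e^{ik_\alpha}|^2\Bigr\}$. *)

(* Defs.v *)
From HB Require Import structures.
From mathcomp Require Import all_boot all_order all_algebra.
From mathcomp Require Import all_classical all_reals all_analysis.
Set Implicit Arguments. Unset Strict Implicit. Unset Printing Implicit Defensive.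
Import Order.TTheory GRing.Theory Num.Theory.
Import numFieldNormedType.Exports.
Local Open Scope classical_set_scope.
Local Open Scope ring_scope.

(* Sites of the torus T_L = Z^3/(LZ)^3, coordinates in {0,...,L-1}. *)
Notation site L := ('I_L * 'I_L * 'I_L)%type.

Definition shift1 L (r : site L) : site L := (ordS r.1.1, r.1.2, r.2).
Definition shift2 L (r : site L) : site L := (r.1.1, ordS r.1.2, r.2).
Definition shift3 L (r : site L) : site L := (r.1.1, r.1.2, ordS r.2).

Definition hamiltonian (R : realType) (J : R) L (th : site L -> R) : R :=
  J / 2 * \sum_(r : site L)
    ( (cos (th r) - cos (th (shift1 r))) ^+ 2
    + (cos (th r - 2 * pi / 3) - cos (th (shift2 r) - 2 * pi / 3)) ^+ 2
    + (cos (th r + 2 * pi / 3) - cos (th (shift3 r) + 2 * pi / 3)) ^+ 2 ).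

Definition angle_close (R : realType) (x y D : R) : Prop :=
  exists k : int, `| x - y - k%:~R * (2 * pi) | < D.

Definition chi (R : realType) L (D thstar : R) (th : site L -> R) : R :=
  if `[< forall r : site L, angle_close (th r) thstar D >] then 1 else 0.

(* Iterated Lebesgue integral over [0,2pi) in each variable listed in s,
   the integrand being a nonnegative function of the configuration.
   (For a nonnegative measurable integrand this is, by Tonelli, the integral
   over [0,2pi)^{T_L} w.r.t. the product Lebesgue measure.) *)
Fixpoint iter_int (R : realType) L (s : seq (site L))
    (f : (site L -> R) -> \bar R) (th : site L -> R) : \bar R :=
  match s with
  | [::] => f th
  | r :: s' =>
      (\int[@lebesgue_measure R]_(t in `[0%R, (2 * pi)%R[%classic)
          iter_int s' f (fun q => if q == r then t else th q))%E
  end.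

Definition partition_fn (R : realType) (J beta D thstar : R) L : \bar R :=
  iter_int (enum [set: site L])
    (fun th => (expR (- (beta * hamiltonian J th)) * chi D thstar th)%:E)
    (fun _ => 0).

Definition F_Delta (R : realType) (J beta D : R) (L : nat) (thstar : R) : R :=
  - (1 / 2) * ln (beta * J / (2 * pi))
  - (L ^ 3)%:R^-1 * ln (fine (partition_fn J beta D thstar L)).

Definition sw_integrand (R : realType) (thstar : R) (k : R * R * R) : R :=
  let q1 := sin thstar ^+ 2 in
  let q2 := sin (thstar - 2 * pi / 3) ^+ 2 in
  let q3 := sin (thstar + 2 * pi / 3) ^+ 2 in
  ln (q1 * (2 - 2 * cos k.1.1) + q2 * (2 - 2 * cos k.1.2)
      + q3 * (2 - 2 * cos k.2)).
(* note |1 - e^{ik}|^2 = 2 - 2 cos k *)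

Definition F_sw (R : realType) (thstar : R) : R :=
  1 / 2 * ((2 * pi) ^+ 3)^-1 *
  Rintegral ((@lebesgue_measure R \x @lebesgue_measure R) \x @lebesgue_measure R)%E
    (`[- pi, pi]%classic `*` `[- pi, pi]%classic `*` `[- pi, pi]%classic)
    (sw_integrand thstar).

(* Main.v *)
Require Import Defs.
From HB Require Import structures.
From mathcomp Require Import all_boot all_order all_algebra.
From mathcomp Require Import all_classical all_reals all_analysis.
From mathcomp Require Import measurable_realfun.
From mathcomp Require Import ring lra.
Set Implicit Arguments. Unset Strict Implicit. Unset Printing Implicit Defensive.
Import Order.TTheory GRing.Theory Num.Theory.
Import numFieldNormedType.Exports.
Local Open Scope classical_set_scope.
Local Open Scope ring_scope.

(** Write [b = beta J] and let [phi] be the offsets of the angles from [thstar].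
    On the box [|phi| < Delta] the energy [beta H] differs from the quadratic form
    [b/2 sum_r sum_a q_a (phi_r - phi_(r+e_a))^2] by at most [12 b Delta^3] per site.
    Adding a mass [lam] to this form gives a symmetric matrix [A] with nonpositive
    off-diagonal entries and row sums [b lam], a class stable under Schur complement,
    so the Gaussian integral over the box can be computed one variable at a time.
    Conditionally on the others, a variable is Gaussian with mean at distance at least
    [lam Delta / (lam + 3)] from the boundary of the box, so each integration costs at
    most a factor [1 - escape], where [escape] is small when [b Delta^2] is large: this
    replaces correlation inequalities.  Hence [log Z] is
    [1/2 log det (2 pi A^-1)] up to a small error per site, plus [b lam Delta^2 / 2] for
    the upper bound, where [lam] may be taken as small as desired.

    The determinant is diagonalised by the real Hartley transform, [1/L^3 log det] is a
    Riemann sum for the spin-wave integral with [lam] added inside the logarithm, and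
    since some [q_a >= 1/2], removing [lam] costs at most
    [C lam^(1/4) int |t|^(-1/2) dt], uniformly in [thstar]. *)

(** * Schur complements of diagonally dominant matrices *)

Section Schur.
Variables (R : realFieldType) (T : eqType).
Implicit Types (A : T -> T -> R) (u : seq T) (x : T -> R).

(** Indexing by the entries of a list makes one elimination step the removal of the head, in
    parallel with the recursion of [iter_int]. *)
Definition seq_mx A u : 'M[R]_(size u) :=
  \matrix_(i, j) A (tnth (in_tuple u) i) (tnth (in_tuple u) j).

Definition quad A u x : R := \sum_(i <- u) \sum_(j <- u) A i j * x i * x j.

Definition schur A r i j : R := A i j - A i r * A r j / A r r.

(** Gaussian elimination: the unipotent block matrix [P] clears the column below the pivot
    [A r r]. *)
Lemma det_schur A r u : A r r != 0 ->
  \det (seq_mx A (r :: u)) = A r r * \det (seq_mx (schur A r) u).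
Proof.
move=> a0; set n := size u.
pose B : 'M[R]_(1, n) := \matrix_(i, j) A r (tnth (in_tuple u) j).
pose C : 'M[R]_(n, 1) := \matrix_(i, j) A (tnth (in_tuple u) i) r.
pose M : 'M[R]_(1 + n) := seq_mx A (r :: u).
have Z : M = block_mx (A r r)%:M B C (seq_mx A u).
  rewrite -[LHS](@submxK _ 1 n 1 n); congr block_mx; apply/matrixP => i j.
  - by rewrite !ord1 !mxE.
  - by rewrite !mxE !(tnth_nth r) ord1.
  - by rewrite !mxE !(tnth_nth r) (ord1 j).
  - by rewrite !mxE !(tnth_nth r).
pose P : 'M[R]_(1 + n) := block_mx 1%:M 0 (- (A r r)^-1 *: C) 1%:M.
have PM : P *m M = block_mx (A r r)%:M B 0 (seq_mx (schur A r) u).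
  rewrite Z mulmx_block !mul1mx !mul0mx !addr0; congr block_mx.
  - rewrite mul_mx_scalar scalerA mulrN divff// scaleN1r.
    by rewrite addrC subrr.
  - apply/matrixP => i j; rewrite !mxE big_ord1 !mxE /schur; ring.
have dP : \det P = 1 by rewrite det_lblock !det1 mulr1.
have := congr1 determinant PM.
by rewrite det_mulmx dP mul1r det_ublock det_scalar1 => <-.
Qed.

(** This is completion of the square in the variable [x r]; what remains in the other variables is
    the form of the Schur complement. *)
Lemma quad_schur A r u x : A r r != 0 -> (forall j, j \in u -> A j r = A r j) ->
  quad A (r :: u) x = quad (schur A r) u x +
    A r r * (x r + (\sum_(j <- u) A r j * x j) / A r r) ^+ 2.
Proof.
move=> a0 sA; rewrite /quad !big_cons; set S := \sum_(j <- u) A r j * x j.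
under [X in _ + X = _]eq_bigr do rewrite big_cons.
rewrite big_split /=.
have -> : \sum_(j <- u) A r j * x r * x j = x r * S.
  by rewrite big_distrr; apply: eq_bigr => j _ /=; ring.
have -> : \sum_(i <- u) A i r * x i * x r = x r * S.
  by rewrite big_distrr; apply: eq_big_seq => j ju /=; rewrite sA//; ring.
have -> : \sum_(i <- u) \sum_(j <- u) schur A r i j * x i * x j =
    \sum_(i <- u) \sum_(j <- u) A i j * x i * x j - S * S / A r r.
  rewrite /S big_distrl /= mulr_suml -sumrB; apply: eq_big_seq => i iu.
  rewrite big_distrr /= mulr_suml -sumrB; apply: eq_bigr => j _.
  by rewrite /schur sA//; ring.
by field.
Qed.

(** As off-diagonal entries are nonpositive, [lam] measures the diagonal dominance. The bound [K] on
    the diagonal limits the precision of every conditional Gaussian met during elimination. *)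
Definition dominant lam K A u :=
  [/\ {in u &, forall i j, A i j = A j i},
      {in u &, forall i j, i != j -> A i j <= 0},
      {in u, forall i, lam <= \sum_(j <- u) A i j} &
      {in u, forall i, A i i <= K}].

(** This bounds conditional means: if the other variables are at most [d] in absolute value, the
    mean of variable [r] is at most [(1 - lam / A r r) * d]. *)
Lemma dominant_offdiag lam K A r u : uniq (r :: u) -> dominant lam K A (r :: u) ->
  \sum_(j <- u) `|A r j| <= A r r - lam.
Proof.
move=> /andP[ru _] [_ neg row _].
have := row r (mem_head _ _); rewrite big_cons => h.
have -> : \sum_(j <- u) `|A r j| = - \sum_(j <- u) A r j.
  rewrite -sumrN; apply: eq_big_seq => j ju; rewrite ler0_norm//.
  by apply: neg; rewrite ?mem_head// ?inE ?ju ?orbT//; apply: contraNneq ru => ->.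
by lra.
Qed.

Lemma dominant_diag lam K A r u : uniq (r :: u) -> dominant lam K A (r :: u) ->
  lam <= A r r <= K.
Proof.
move=> ur dA; have := dominant_offdiag ur dA.
have : 0 <= \sum_(j <- u) `|A r j| by apply: sumr_ge0.
by case: dA => _ _ _ /(_ r (mem_head _ _)) ? ? ?; apply/andP; split; lra.
Qed.

(* Eliminating a variable keeps off-diagonal entries nonpositive and can only
   increase the row sums. *)
Lemma dominant_schur lam K A r u : 0 < lam -> uniq (r :: u) ->
  dominant lam K A (r :: u) -> dominant lam K (schur A r) u.
Proof.
move=> l0 ur dA; have /andP[ge_l le_K] := dominant_diag ur dA.
have a0 : 0 < A r r by lra.
move: ur => /andP[ru uu]; case: dA => sA neg row diag.
have inr j : j \in u -> j \in r :: u by rewrite inE => ->; rewrite orbT.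
have rin := mem_head r u.
have ner j : j \in u -> A j r <= 0.
  move=> ju; apply: neg; [exact: inr|exact: rin|].
  by apply: contraNneq ru => <-.
split.
- move=> i j iu ju; rewrite /schur (sA i j (inr _ iu) (inr _ ju)).
  by rewrite (sA i r (inr _ iu) rin) (sA r j rin (inr _ ju)); ring.
- move=> i j iu ju ij; rewrite /schur.
  have := neg i j (inr _ iu) (inr _ ju) ij.
  have : 0 <= A i r * A r j / A r r.
    by rewrite divr_ge0 ?(ltW a0)// mulr_le0 ?ner// (sA r j rin (inr _ ju)) ner.
  by move=> ? ?; lra.
- move=> i iu; have := row i (inr _ iu); rewrite big_cons => h1.
  have := row r rin; rewrite big_cons => h2.
  rewrite /schur sumrB -mulr_suml -mulr_sumr.
  set S := \sum_(j <- u) A r j in h2 *.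
  (* The new row sum at [i] is the old one minus this quantity, in which [A r r + S] is the positive
     row sum at [r]. *)
  have : A i r * (A r r + S) / A r r <= 0.
    rewrite pmulr_lle0 ?invr_gt0//; apply: mulr_le0_ge0; rewrite ?ner//.
    by apply: le_trans h2; exact: ltW.
  rewrite mulrDr mulrDl mulfK ?gt_eqF// => h3.
  by lra.
- move=> i iu; have := diag i (inr _ iu).
  have : 0 <= A i r * A r i / A r r.
    by rewrite divr_ge0 ?(ltW a0)// mulr_le0 ?ner// (sA r i rin (inr _ iu)) ner.
  by rewrite /schur => ? ?; lra.
Qed.

Lemma det_dominant_gt0 lam K A u : 0 < lam -> uniq u -> dominant lam K A u ->
  0 < \det (seq_mx A u).
Proof.
move=> l0; elim: u A => [|r u IH] A uu dA; first by rewrite det_mx00.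
have /andP[ge_l _] := dominant_diag uu dA.
have a0 : 0 < A r r by lra.
rewrite det_schur ?gt_eqF// mulr_gt0// IH//; first by case/andP: uu.
exact: dominant_schur dA.
Qed.
End Schur.

(** The columns of [H] are eigenvectors, so [A H = H diag(ev)]. Orthogonality gives [H^T H = c I],
    hence [det H] is nonzero and cancels. *)
Lemma det_seq_mx_eigen (R : realFieldType) (T : finType) (u : seq T)
    (A H : T -> T -> R) (ev : T -> R) (c : R) :
  uniq u -> (forall x, x \in u) -> c != 0 ->
  (forall x k, \sum_y A x y * H y k = H x k * ev k) ->
  (forall k l, \sum_x H x k * H x l = c * (k == l)%:R) ->
  \det (seq_mx A u) = \prod_k ev k.
Proof.
move=> uu inu c0 AH HH.
have pu : perm_eq u (index_enum T).
  by apply: uniq_perm; rewrite ?index_enum_uniq// => x; rewrite inu mem_index_enum.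
pose t := tnth (in_tuple u).
have sumE (F : T -> R) : \sum_(i < size u) F (t i) = \sum_x F x.
  by rewrite -(big_tuple _ _ (in_tuple u) xpredT F); exact: perm_big.
have prodE : \prod_(i < size u) ev (t i) = \prod_k ev k.
  by rewrite -(big_tuple _ _ (in_tuple u) xpredT ev); exact: perm_big.
pose M := seq_mx H u.
pose d : 'rV[R]_(size u) := \row_k ev (t k).
have tI : injective t by apply/tuple_uniqP.
have E1 : seq_mx A u *m M = M *m diag_mx d.
  apply/matrixP => i k; rewrite mul_mx_diag !mxE -AH -sumE.
  by apply: eq_bigr => j _; rewrite !mxE.
have E2 : M^T *m M = c%:M.
  apply/matrixP => k l; rewrite !mxE.
  under eq_bigr do rewrite !mxE.
  by rewrite (sumE (fun x => H x (t k) * H x (t l))) HH (inj_eq tI) mulr_natr.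
have dM : \det M != 0.
  apply: contraNneq (expf_neq0 (size u) c0) => dM0.
  by have := congr1 determinant E2; rewrite det_mulmx dM0 mulr0 det_scalar => <-.
have := congr1 determinant E1; rewrite !det_mulmx det_diag mulrC => /(mulfI dM) ->.
by rewrite -prodE; apply: eq_bigr => k _; rewrite mxE.
Qed.

(** * Directional Laplacians and the Hartley transform *)

Section DirectionalLaplacian.
Variables (R : realFieldType) (T : finType).
Implicit Types (s : T -> T) (F : T -> R).

(** The indicators are added with multiplicity, so that the formula stays correct on small tori,
    where a site and its two neighbours may coincide. *)
Definition lapl s (i j : T) : R :=
  2 * (i == j)%:R - (j == s i)%:R - (i == s j)%:R.

Lemma sum_delta F x : \sum_y (y == x)%:R * F y = F x.
Proof.
by rewrite (bigD1 x)//= eqxx mul1r big1 ?addr0// => y /negbTE ->; rewrite mul0r.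
Qed.

(** Evaluating at the row [s z] lets both neighbours, [s (s z)] and [z], be named without an inverse
    of [s]. *)
Lemma lapl_apply s F z : injective s ->
  \sum_y lapl s (s z) y * F y = 2 * F (s z) - F (s (s z)) - F z.
Proof.
move=> si; rewrite -(sum_delta F (s z)) -(sum_delta F (s (s z))) -(sum_delta F z).
rewrite mulr_sumr -!sumrB; apply: eq_bigr => y _.
by rewrite /lapl (inj_eq si) (eq_sym z) (eq_sym (s z) y); ring.
Qed.

Lemma lapl_sym s i j : lapl s i j = lapl s j i.
Proof. by rewrite /lapl (eq_sym j i); ring. Qed.

Lemma lapl_offdiag s i j : i != j -> lapl s i j <= 0.
Proof.
move=> /negbTE ij; rewrite /lapl ij mulr0.
by have := ler0n R (j == s i); have := ler0n R (i == s j); lra.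
Qed.

Lemma lapl_diag s i : lapl s i i <= 2.
Proof. by rewrite /lapl eqxx mulr1; have := ler0n R (i == s i); lra. Qed.

Lemma lapl_row s i : injective s -> \sum_j lapl s i j = 0.
Proof.
move=> si; have [g _ gK] := injF_bij si; rewrite -(gK i).
have := lapl_apply (fun=> 1) (g i) si.
by under eq_bigr do rewrite mulr1; move=> ->; lra.
Qed.

Lemma lapl_quad s F : injective s ->
  \sum_i \sum_j lapl s i j * F i * F j = \sum_i (F i - F (s i)) ^+ 2.
Proof.
move=> si.
have E : \sum_i F (s i) ^+ 2 = \sum_i F i ^+ 2.
  rewrite [RHS](reindex_inj si)/=; exact: eq_bigr.
have -> : \sum_i (F i - F (s i)) ^+ 2 =
    \sum_i (F i ^+ 2 + F (s i) ^+ 2 - 2 * (F i * F (s i))).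
  by apply: eq_bigr => i _; ring.
rewrite sumrB big_split /= E.
rewrite (reindex_inj si)/=.
under eq_bigr => i _.
  under eq_bigr => j _ do rewrite mulrAC.
  rewrite -mulr_suml lapl_apply//.
  over.
rewrite (_ : \sum_i _ = \sum_i 2 * F (s i) ^+ 2 - \sum_i F (s i) * F (s (s i)) - \sum_i F i * F (s i)).
  have -> : \sum_i F (s i) * F (s (s i)) = \sum_i F i * F (s i).
    by rewrite [RHS](reindex_inj si).
  by rewrite -!mulr_sumr E; ring.
by rewrite -!sumrB; apply: eq_bigr => i _; ring.
Qed.
End DirectionalLaplacian.

(** * Real trigonometric eigenvectors of the cyclic shift *)

Section Hartley.
Variable R : realType.
Implicit Types (x y t w : R).

(** The Hartley kernel, a real substitute for [exp(i x)] that diagonalises the Laplacian without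
    complex numbers. *)
Definition cas x : R := cos x + sin x.

Lemma casDB x y : cas (x + y) + cas (x - y) = 2 * cos y * cas x.
Proof. by rewrite /cas cosD cosB sinD sinB; ring. Qed.

Lemma casM x y : cas x * cas y = cos (x - y) + sin (x + y).
Proof. by rewrite /cas cosB sinD; ring. Qed.

Lemma mulr2pin n : 2 * pi * n%:R = pi *+ 2 *+ n :> R.
Proof. by rewrite -[RHS]mulr_natr -[pi *+ 2]mulr_natl. Qed.

Lemma cas_2pin x n : cas (x + 2 * pi * n%:R) = cas x.
Proof.
by rewrite /cas mulr2pin (periodicn (@cosD2pi R)) (periodicn (@sinD2pi R)).
Qed.

Lemma cos2pin n : cos (2 * pi * n%:R) = 1 :> R.
Proof. by rewrite -[X in cos X]add0r mulr2pin (periodicn (@cosD2pi R)) cos0. Qed.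

Lemma sin2pin n : sin (2 * pi * n%:R) = 0 :> R.
Proof. by rewrite -[X in sin X]add0r mulr2pin (periodicn (@sinD2pi R)) sin0. Qed.

(** Multiplying by [sin (w / 2)] turns the sum into a telescoping one, whose two end terms agree by
    periodicity. *)
Lemma sum_cos_period w L : cos (L%:R * w) = 1 -> sin (L%:R * w) = 0 ->
  sin (w / 2) != 0 -> \sum_(j < L) cos (j%:R * w) = 0.
Proof.
move=> c1 s0 h; apply: (mulfI h); rewrite mulr0 mulr_sumr.
pose F (j : nat) := sin (j%:R * w - w / 2) / 2.
have -> : \sum_(j < L) sin (w / 2) * cos (j%:R * w) = \sum_(j < L) (F j.+1 - F j).
  apply: eq_bigr => j _; rewrite /F -[j.+1%:R]natr1.
  rewrite (_ : (j%:R + 1) * w - w / 2 = j%:R * w + w / 2); last by field.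
  by rewrite sinD sinB; field.
rewrite -(big_mkord xpredT (fun j => F j.+1 - F j)) telescope_sumr// /F.
by rewrite !sinB c1 s0 (mul0r w) sin0 cos0; ring.
Qed.

(** The same telescoping works when [sin (w / 2)] is nonzero; when it vanishes, every sine in the
    sum is already zero. *)
Lemma sum_sin_period w L : cos (L%:R * w) = 1 -> sin (L%:R * w) = 0 ->
  \sum_(j < L) sin (j%:R * w) = 0.
Proof.
move=> c1 s0; have [h|h] := eqVneq (sin (w / 2)) 0.
  have sw : sin w = 0.
    by rewrite (_ : w = w / 2 + w / 2) ?sinD ?h; [ring|field].
  apply: big1 => j _; elim: (nat_of_ord j) => [|n IH]; first by rewrite mul0r sin0.
  by rewrite -natr1 mulrDl mul1r sinD IH sw; ring.
apply: (mulfI h); rewrite mulr0 mulr_sumr.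
pose F (j : nat) := - cos (j%:R * w - w / 2) / 2.
have -> : \sum_(j < L) sin (w / 2) * sin (j%:R * w) = \sum_(j < L) (F j.+1 - F j).
  apply: eq_bigr => j _; rewrite /F -[j.+1%:R]natr1.
  rewrite (_ : (j%:R + 1) * w - w / 2 = j%:R * w + w / 2); last by field.
  by rewrite cosD cosB; field.
rewrite -(big_mkord xpredT (fun j => F j.+1 - F j)) telescope_sumr// /F.
by rewrite !cosB c1 s0 (mul0r w) sin0 cos0; ring.
Qed.

Definition freq L (k : 'I_L) : R := 2 * pi * k%:R / L%:R.

Definition hart L (j k : 'I_L) : R := cas (j%:R * freq k).

(** At the last site the successor wraps to 0, and the argument changes by [L * freq k = 2 pi k], a
    period. The free phase [t] lets the lemma serve both neighbours of a site. *)
Lemma cas_ordS L (j k : 'I_L) t :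
  cas ((ordS j)%:R * freq k + t) = cas (j%:R * freq k + freq k + t).
Proof.
have L0 : L%:R != 0 :> R by rewrite pnatr_eq0 -lt0n (leq_ltn_trans _ (ltn_ord j)).
have -> : j%:R * freq k + freq k + t = j.+1%:R * freq k + t by rewrite -natr1; ring.
have [jL|jL] := eqVneq j.+1 L.
  rewrite /= jL modnn mul0r add0r (_ : _ + t = t + 2 * pi * k%:R) ?cas_2pin//.
  by rewrite /freq; field.
by rewrite /= modn_small// ltn_neqAle jL ltn_ord.
Qed.

Lemma hart_shift L (z k : 'I_L) :
  hart (ordS (ordS z)) k + hart z k = 2 * cos (freq k) * hart (ordS z) k.
Proof.
rewrite /hart -casDB; congr (_ + _); last by rewrite cas_ordS addrK.
by rewrite -[X in cas X]addr0 cas_ordS addr0.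
Qed.

Lemma sin_half_freqB L (k l : 'I_L) : k != l -> sin ((freq k - freq l) / 2) != 0.
Proof.
wlog kl : k l / (l < k)%N => [H kl|_].
  have /orP[h|h] : (l < k)%N || (k < l)%N by rewrite -neq_ltn eq_sym.
  - exact: H.
  - rewrite -opprB mulNr sinN oppr_eq0; apply: H => //; by rewrite eq_sym.
have L0 : 0 < L%:R :> R by rewrite ltr0n (leq_ltn_trans _ (ltn_ord k)).
rewrite gt_eqF// sin_gt0_pi//.
have -> : (freq k - freq l) / 2 = pi * ((k - l)%N%:R / L%:R).
  by rewrite natrB ?(ltnW kl)// /freq; field; rewrite gt_eqF.
have p0 := @pi_gt0 R.
apply/andP; split; first by rewrite mulr_gt0// divr_gt0// ltr0n subn_gt0.
rewrite gtr_pMr// ltr_pdivrMr// mul1r ltr_nat.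
by rewrite (leq_ltn_trans _ (ltn_ord k))// leq_subr.
Qed.

(** By [casM] each product is a cosine of the frequency difference plus a sine of the frequency sum.
    The sines always sum to zero, the cosines unless [k = l]. *)
Lemma hart_orthogonal L (k l : 'I_L) :
  \sum_(j < L) hart j k * hart j l = L%:R * (k == l)%:R.
Proof.
have L0 : L%:R != 0 :> R by rewrite pnatr_eq0 -lt0n (leq_ltn_trans _ (ltn_ord k)).
have Lf (m : 'I_L) : L%:R * freq m = 2 * pi * m%:R by rewrite /freq; field.
under eq_bigr do rewrite /hart casM -mulrBr -mulrDr.
rewrite big_split /= [X in _ + X]sum_sin_period ?addr0; last 2 first.
- by rewrite mulrDr cosD !Lf !cos2pin !sin2pin; ring.
- by rewrite mulrDr sinD !Lf !cos2pin !sin2pin; ring.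
have [->|kl] := eqVneq k l.
  under eq_bigr do rewrite subrr mulr0 cos0.
  by rewrite sumr_const card_ord mulr1.
rewrite sum_cos_period ?mulr0// ?sin_half_freqB//.
- by rewrite mulrBr cosB !Lf !cos2pin !sin2pin; ring.
- by rewrite mulrBr sinB !Lf !cos2pin !sin2pin; ring.
Qed.
End Hartley.

(** * The massive Laplacian on the torus and its determinant *)

Section Torus.
Variables (R : realType) (L : nat).
Implicit Types (q lam b : R) (r : site L).

Lemma ordS_inj : injective (@ordS L). Proof. exact: bij_inj (@ordS_bij L). Qed.

Lemma shift1_inj : injective (@shift1 L).
Proof.
move=> [[a1 b1] c1] [[a2 b2] c2] e.
by rewrite (ordS_inj (congr1 (fun r : site L => r.1.1) e : ordS a1 = ordS a2))
  (congr1 (fun r : site L => r.1.2) e : b1 = b2)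
  (congr1 (fun r : site L => r.2) e : c1 = c2).
Qed.

Lemma shift2_inj : injective (@shift2 L).
Proof.
move=> [[a1 b1] c1] [[a2 b2] c2] e.
by rewrite (congr1 (fun r : site L => r.1.1) e : a1 = a2)
  (ordS_inj (congr1 (fun r : site L => r.1.2) e : ordS b1 = ordS b2))
  (congr1 (fun r : site L => r.2) e : c1 = c2).
Qed.

Lemma shift3_inj : injective (@shift3 L).
Proof.
move=> [[a1 b1] c1] [[a2 b2] c2] e.
by rewrite (congr1 (fun r : site L => r.1.1) e : a1 = a2)
  (congr1 (fun r : site L => r.1.2) e : b1 = b2)
  (ordS_inj (congr1 (fun r : site L => r.2) e : ordS c1 = ordS c2)).
Qed.

(** Here [b] stands for [beta J]. The mass [lam] makes the form definite: without it constant
    configurations have energy zero. *)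
Definition torus_mx q1 q2 q3 lam b (i j : site L) : R :=
  b * (lam * (i == j)%:R + q1 * lapl R (@shift1 L) i j
       + q2 * lapl R (@shift2 L) i j + q3 * lapl R (@shift3 L) i j).

Definition dispersion q1 q2 q3 (x y z : R) : R :=
  q1 * (2 - 2 * cos x) + q2 * (2 - 2 * cos y) + q3 * (2 - 2 * cos z).

Lemma sum_seqT (u : seq (site L)) (F : site L -> R) :
  uniq u -> (forall r, r \in u) -> \sum_(r <- u) F r = \sum_r F r.
Proof.
move=> uu inu; apply: perm_big.
by apply: uniq_perm; rewrite ?index_enum_uniq// => x; rewrite inu mem_index_enum.
Qed.

Lemma torus_mx_dominant q1 q2 q3 lam b (u : seq (site L)) :
  0 <= q1 -> 0 <= q2 -> 0 <= q3 -> 0 < b -> uniq u -> (forall r, r \in u) ->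
  dominant (b * lam) (b * (lam + 2 * (q1 + q2 + q3)))
           (torus_mx q1 q2 q3 lam b) u.
Proof.
move=> q1_ge0 q2_ge0 q3_ge0 b0 uu inu; split.
- move=> i j _ _; rewrite /torus_mx eq_sym.
  by rewrite (lapl_sym _ _ i) (lapl_sym _ (@shift2 L) i) (lapl_sym _ (@shift3 L) i).
- move=> i j _ _ ij; rewrite /torus_mx (negbTE ij) mulr0 add0r pmulr_rle0//.
  have h (q : R) s : 0 <= q -> q * lapl R s i j <= 0.
    by move=> q0; rewrite mulr_ge0_le0// lapl_offdiag.
  by have := h _ (@shift1 L) q1_ge0; have := h _ (@shift2 L) q2_ge0;
     have := h _ (@shift3 L) q3_ge0; lra.
- move=> i _; rewrite sum_seqT// -mulr_sumr !big_split /= -!mulr_sumr.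
  rewrite !lapl_row; [|exact: shift3_inj|exact: shift2_inj|exact: shift1_inj].
  have -> : \sum_j (i == j)%:R = 1 :> R.
    rewrite -[RHS](sum_delta (fun=> 1) i); apply: eq_bigr => j _.
    by rewrite mulr1 eq_sym.
  by rewrite mulr1 !mulr0 !addr0.
- move=> i _; rewrite /torus_mx eqxx mulr1 ler_wpM2l ?(ltW b0)//.
  have h (q : R) s : 0 <= q -> q * lapl R s i i <= q * 2.
    by move=> q0; rewrite ler_wpM2l// lapl_diag.
  by have := h _ (@shift1 L) q1_ge0; have := h _ (@shift2 L) q2_ge0;
     have := h _ (@shift3 L) q3_ge0; lra.
Qed.

Lemma torus_mx_quad q1 q2 q3 lam b (u : seq (site L)) (x : site L -> R) :
  uniq u -> (forall r, r \in u) ->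
  quad (torus_mx q1 q2 q3 lam b) u x =
  b * (lam * \sum_r x r ^+ 2 + \sum_r (q1 * (x r - x (shift1 r)) ^+ 2
    + q2 * (x r - x (shift2 r)) ^+ 2 + q3 * (x r - x (shift3 r)) ^+ 2)).
Proof.
move=> uu inu; rewrite /quad sum_seqT//.
rewrite !big_split /= -!mulr_sumr.
rewrite -(lapl_quad _ shift1_inj) -(lapl_quad _ shift2_inj) -(lapl_quad _ shift3_inj).
rewrite !mulr_sumr -!big_split/= mulr_sumr; apply: eq_bigr => i _.
rewrite sum_seqT//; have -> : x i ^+ 2 = \sum_j (j == i)%:R * (x i * x j).
  by rewrite (sum_delta (fun j => x i * x j)).
rewrite !mulr_sumr -!big_split/= mulr_sumr; apply: eq_bigr => j _.
by rewrite /torus_mx (eq_sym j i); ring.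
Qed.

Lemma sum_site (f g h : 'I_L -> R) :
  \sum_(r : site L) f r.1.1 * g r.1.2 * h r.2 =
  (\sum_i f i) * (\sum_i g i) * (\sum_i h i).
Proof.
rewrite big_distrlr /= pair_bigA big_distrlr /= pair_bigA /=.
by apply: eq_bigr => -[[]].
Qed.

(** Products of three one-dimensional Hartley functions are orthogonal eigenvectors with squared
    norm [L^3]. *)
Lemma torus_mx_det q1 q2 q3 lam b (u : seq (site L)) :
  uniq u -> (forall r, r \in u) ->
  \det (seq_mx (torus_mx q1 q2 q3 lam b) u) =
  \prod_(k : site L) (b * (lam + dispersion q1 q2 q3
     (freq R k.1.1) (freq R k.1.2) (freq R k.2))).
Proof.
move=> uu inu.
(* For [L = 0] there are no sites and both sides are 1; otherwise the squared norm [L^3] is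
   nonzero. *)
case: (posnP L) => [L0|L0].
  have e0 (r : site L) : False.
    by have := leq_ltn_trans (leq0n _) (ltn_ord r.2); rewrite L0.
  have -> : u = [::] by case: u {uu inu} => // r; have := e0 r.
  by rewrite det_mx00 big1// => k; have := e0 k.
pose H (r k : site L) : R := hart R r.1.1 k.1.1 * hart R r.1.2 k.1.2 * hart R r.2 k.2.
apply: (@det_seq_mx_eigen _ _ _ _ H _ (L%:R * L%:R * L%:R)) => //.
- by rewrite !mulf_neq0 ?pnatr_eq0 -?lt0n.
- move=> x k; have [g _ gK] := ordS_bij L.
  transitivity (b * (lam * (\sum_y (y == x)%:R * H y k)
      + q1 * (\sum_y lapl R (@shift1 L) x y * H y k)
      + q2 * (\sum_y lapl R (@shift2 L) x y * H y k)
      + q3 * (\sum_y lapl R (@shift3 L) x y * H y k))).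
    rewrite !mulr_sumr -!big_split /= mulr_sumr.
    by apply: eq_bigr => y _; rewrite /torus_mx (eq_sym y); ring.
  rewrite (sum_delta (H^~ k)).
  (* Every coordinate is written as a successor, the form in which [lapl_apply] evaluates the
     Laplacian. *)
  case: x => [[x1 x2] x3]; rewrite -(gK x1) -(gK x2) -(gK x3).
  set y1 := g x1; set y2 := g x2; set y3 := g x3.
  rewrite (@lapl_apply _ _ _ (H^~ k) (y1, ordS y2, ordS y3)); last exact: shift1_inj.
  rewrite (@lapl_apply _ _ _ (H^~ k) (ordS y1, y2, ordS y3)); last exact: shift2_inj.
  rewrite (@lapl_apply _ _ _ (H^~ k) (ordS y1, ordS y2, y3)); last exact: shift3_inj.
  rewrite /H /shift1 /shift2 /shift3 /dispersion /=.
  have e (z l : 'I_L) : hart R (ordS (ordS z)) l =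
      2 * cos (freq R l) * hart R (ordS z) l - hart R z l.
    by rewrite -hart_shift addrK.
  by rewrite !e; ring.
- move=> k l; transitivity (\sum_(r : site L) (hart R r.1.1 k.1.1 * hart R r.1.1 l.1.1) *
     (hart R r.1.2 k.1.2 * hart R r.1.2 l.1.2) * (hart R r.2 k.2 * hart R r.2 l.2)).
    by apply: eq_bigr => r _; rewrite /H; ring.
  rewrite (sum_site (fun i => hart R i k.1.1 * hart R i l.1.1)
     (fun i => hart R i k.1.2 * hart R i l.1.2) (fun i => hart R i k.2 * hart R i l.2)).
  rewrite !hart_orthogonal.
  case: k l => [[k1 k2] k3] [[l1 l2] l3] /=.
  rewrite -[((_, _, _) == _)]/((k1 == l1) && (k2 == l2) && (k3 == l3)).
  by case: eqP; case: eqP; case: eqP => _ _ _ /=; ring.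
Qed.
End Torus.

(** * Translations, angles and one-dimensional Gaussian integrals *)

Section Integrals.
Variable R : realType.
Notation mu := (@lebesgue_measure R).

(* Unlike [ge0_le_integral], no measurability is required. *)
Lemma le_ge0_integral d (T : measurableType d) (m : {measure set T -> \bar R})
    (D : set T) (f g : T -> \bar R) :
  (forall x, D x -> (0 <= f x)%E) -> (forall x, D x -> (f x <= g x)%E) ->
  (\int[m]_(x in D) f x <= \int[m]_(x in D) g x)%E.
Proof.
move=> f0 fg; have g0 x : D x -> (0 <= g x)%E by move=> Dx; exact: le_trans (f0 _ Dx) (fg _ Dx).
rewrite !ge0_integralE//; apply: ge_ereal_sup => _ [h /= hf <-].
apply: ereal_sup_ubound; exists h => //= x; apply: le_trans (hf x) _.
by rewrite /patch; case: ifPn => // /set_mem /fg.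
Qed.

Lemma measurable_addr (c : R) : measurable_fun setT (fun x : R => x + c).
Proof. by apply: measurable_funD. Qed.

(** Lebesgue measure is determined by its values on half-open intervals, whose length a translation
    preserves. *)
Lemma lebesgue_measure_translate (c : R) (A : set R) : measurable A ->
  pushforward mu ((fun x => x + c) : measurableTypeR R -> measurableTypeR R) A = mu A.
Proof.
move=> mA; apply/esym/lebesgue_measure_unique; [exact: measurable_addr| |by []].
move=> mf _ [[a b]] _ <- /=.
rewrite /pushforward.
have -> : (fun x : R => x + c) @^-1` `]a, b] = `]a - c, b - c]%classic.
  by apply/seteqP; split => x /=; rewrite !in_itv/= ltrBlDr lerBrDr.
rewrite !lebesgue_measure_itv/= !lte_fin ltrD2r.
by case: ifP => // _; rewrite -!EFinB; congr (_%:E); ring.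
Qed.

Lemma integral_translate (c : R) (D : set R) (f : R -> \bar R) :
  measurable D -> measurable_fun setT f ->
  (\int[mu]_(x in D) f x = \int[mu]_(x in [set x | D (x + c)%R]) f (x + c)%R)%E.
Proof.
move=> mD mf.
have ge0 (g : R -> \bar R) : measurable_fun setT g -> (forall x, (0 <= g x)%E) ->
  (\int[mu]_(x in D) g x = \int[mu]_(x in [set x | D (x + c)%R]) g (x + c)%R)%E.
  move=> mg g0.
  rewrite -[RHS](@ge0_integral_pushforward _ _ _ _ _
    ((fun x => x + c) : measurableTypeR R -> measurableTypeR R) _ mu D g)//=.
  - apply: eq_measure_integral; first exact: measurable_addr.
    by move=> ? A mA _; exact/esym/lebesgue_measure_translate.
  - exact: measurable_addr.
  - exact: measurable_funS mg.
rewrite integralE [RHS]integralE; congr (_ - _)%E.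
- rewrite (ge0 (f^\+)%E); [by apply: eq_integral => x _; rewrite !(funeposE, funenegE)|exact: measurable_funepos|by []].
- rewrite (ge0 (f^\-)%E); [by apply: eq_integral => x _; rewrite !(funeposE, funenegE)|exact: measurable_funeneg|by []].
Qed.

(** The window starting at [c] arises from the one starting at [a] by moving the piece [[a, c[] up
    by one period. *)
Lemma integral_period (p a c : R) (f : R -> \bar R) : measurable_fun setT f ->
  (forall x, f (x + p) = f x) -> a <= c -> c <= a + p ->
  (\int[mu]_(x in `[a, (a + p)%R[) f x = \int[mu]_(x in `[c, (c + p)%R[) f x)%E.
Proof.
move=> mf per ac cp.
have cut (x y z : R) : x <= y -> y <= z ->
    (\int[mu]_(t in `[x, z[) f t = \int[mu]_(t in `[x, y[) f t + \int[mu]_(t in `[y, z[) f t)%E.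
  move=> xy yz; rewrite -integral_setU//.
  - congr (integral _ _ _); rewrite -itv_bndbnd_setU//= ?bnd_simp//.
  - exact: measurable_funS mf.
  - apply/disj_setPS => t [] /=; rewrite !in_itv/= => /andP[_ ty] /andP[yt _].
    by have := lt_le_trans ty yt; rewrite ltxx.
rewrite (cut a c (a + p)) ?(cut c (a + p) (c + p))// ?lerD2r// addeC; congr (_ + _)%E.
rewrite [RHS](@integral_translate p)//.
have -> : [set x | `[(a + p)%R, (c + p)%R[%classic (x + p)] = `[a, c[%classic.
  by apply/seteqP; split => x /=; rewrite !in_itv/= lerD2r ltrD2r.
by apply: eq_integral => x _; rewrite per.
Qed.
End Integrals.

(** * Angles as offsets from a reference direction *)

Section Wrap.
Variable R : realType.
Notation mu := (@lebesgue_measure R).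
Implicit Types (c t x d : R).

(** The representative of [t - c] modulo [2 pi] in [[- pi, pi[]. *)
Definition offset c t : R :=
  t - c - (Num.floor ((t - c + pi) / (2 * pi)))%:~R * (2 * pi).

Lemma twopi_gt0 : 0 < 2 * pi :> R. Proof. by rewrite mulr_gt0 ?pi_gt0. Qed.

Lemma offset_itv c t : - pi <= offset c t < pi.
Proof.
have p0 := twopi_gt0; rewrite /offset; set k := Num.floor _.
have /andP[h1 h2] := floor_itv ((t - c + pi) / (2 * pi)).
rewrite -/k ler_pdivlMr// in h1; rewrite -/k ltr_pdivrMr// intrD mulrDl mul1r in h2.
by apply/andP; split; lra.
Qed.

Lemma offset_uniq c t x (k : int) : - pi <= x < pi ->
  t = c + x + k%:~R * (2 * pi) -> offset c t = x.
Proof.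
move=> /andP[x1 x2] ->; have p0 := twopi_gt0; rewrite /offset.
rewrite (@floor_def _ _ k); first by ring.
rewrite ler_pdivlMr// ltr_pdivrMr// intrD mulrDl mul1r.
by apply/andP; split; lra.
Qed.

Lemma offsetE c t : exists k : int, t = c + offset c t + k%:~R * (2 * pi).
Proof. by exists (Num.floor ((t - c + pi) / (2 * pi))); rewrite /offset; ring. Qed.

Lemma offset_period c t : offset c (t + 2 * pi) = offset c t.
Proof.
have [k tE] := offsetE c t.
apply: (@offset_uniq _ _ _ (k + 1)); first exact: offset_itv.
by rewrite {1}tE intrD; ring.
Qed.

(** For [d <= pi], a representative smaller than [d] lies in [[- pi, pi[], so it must be the
    offset. *)
Lemma angle_closeE c t d : d <= pi -> angle_close t c d <-> `|offset c t| < d.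
Proof.
move=> dpi; split => [[k]|wd]; last first.
  have [k tE] := offsetE c t; exists k.
  by rewrite (_ : _ - _ = offset c t)// {1}tE; ring.
move=> h; rewrite (@offset_uniq _ _ (t - c - k%:~R * (2 * pi)) k)//; last by ring.
by move: h; rewrite ltr_norml => /andP[h1 h2]; apply/andP; split; lra.
Qed.

Lemma measurable_offset c : measurable_fun setT (offset c).
Proof.
apply: measurable_funB; first exact: measurable_funB.
apply: measurable_funM => //.
apply: nondecreasing_measurable => // x y xy.
rewrite ler_int; apply: le_floor.
rewrite ler_pM2r ?invr_gt0 ?twopi_gt0//; lra.
Qed.

Lemma cos_2pi_int x (k : int) : cos (x + k%:~R * (2 * pi)) = cos x.
Proof.
have e (n : nat) (y : R) : cos (y + n%:R * (2 * pi)) = cos y.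
  rewrite (_ : n%:R * (2 * pi) = pi *+ 2 *+ n); first exact: (periodicn (@cosD2pi R)).
  by rewrite -[RHS]mulr_natl -[pi *+ 2]mulr_natl.
case: k => n; first exact: e.
rewrite NegzE mulrNz mulNr.
by have := e n.+1 (x - n.+1%:R * (2 * pi)); rewrite subrK => ->.
Qed.

Lemma cos_offset c t x : cos (t + x) = cos (c + offset c t + x).
Proof.
have [k {1}->] := offsetE c t.
by rewrite -[RHS](cos_2pi_int _ k); congr cos; ring.
Qed.

(** By periodicity the window [[0, 2 pi[] may be recentred at [c], where the offset is simply
    [t - c]. *)
Lemma integral_offset c d (g : R -> R) : 0 <= c -> c < 2 * pi -> d <= pi ->
  measurable_fun setT g ->
  (\int[mu]_(t in `[0%R, (2 * pi)%R[)
      (if `|offset c t| < d then g (offset c t) else 0)%:E =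
   \int[mu]_(x in `](- d)%R, d[) (g x)%:E)%E.
Proof.
move=> c0 c2 dpi mg.
have mh : measurable_fun setT (fun x : R => if `|x| < d then g x else 0).
  by apply: measurable_fun_ifT => //; apply: measurable_fun_ltr => //; exact: measurableT_comp.
pose h x : R := if `|x| < d then g x else 0.
have mhw : measurable_fun setT (fun t => (h (offset c t))%:E).
  apply/measurable_EFinP; apply: measurableT_comp => //; exact: measurable_offset.
have per t : (h (offset c (t + 2 * pi)))%:E = (h (offset c t))%:E by rewrite offset_period.
have pp := @pi_gt0 R.
transitivity (\int[mu]_(t in `[(c - pi)%R, (c - pi + 2 * pi)%R[) (h (offset c t))%:E)%E.
  rewrite -{1}(add0r (2 * pi)).
  (* [integral_period] moves a window to the right only, so the direction depends on the sign of
     [c - pi]. *)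
  have [cp|cp] := leP c pi.
  - by apply/esym; apply: integral_period => //; lra.
  - by apply: integral_period => //; lra.
rewrite (@integral_translate _ c)//.
have -> : [set x | `[(c - pi)%R, (c - pi + 2 * pi)%R[%classic (x + c)] = `[(- pi)%R, pi[%classic.
  by apply/seteqP; split => x /=; rewrite !in_itv/= => /andP[? ?]; apply/andP; split; lra.
transitivity (\int[mu]_(x in `[(- pi)%R, pi[) (h x)%:E)%E.
  apply: eq_integral => x; rewrite inE/= in_itv/= => xpi.
  by rewrite (@offset_uniq _ _ x 0)//; ring.
rewrite integral_mkcond [RHS]integral_mkcond; apply: eq_integral => x _.
rewrite /patch !mem_setE !in_itv/= -ltr_norml /h.
case: (ltP `|x| d) => [xd|_]; last by case: ifP.
rewrite ifT//; move: xd; rewrite ltr_norml => /andP[? ?].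
by apply/andP; split; lra.
Qed.
End Wrap.

(** * One-dimensional Gaussian integrals over an interval *)

Section Gauss.
Variable R : realType.
Notation mu := (@lebesgue_measure R).
Implicit Types (a m d e x : R).

Definition gauss a m x : R := expR (- (a / 2) * (x - m) ^+ 2).

Lemma measurable_gauss a m : measurable_fun setT (gauss a m).
Proof.
apply: measurableT_comp => //; apply: measurable_funM => //.
by apply: measurable_funX; apply: measurable_funB.
Qed.

(** The normal density with standard deviation [a^(-1/2)] has mass one, so the integral is the
    inverse of its peak value. *)
Lemma integral_gauss a m : 0 < a ->
  (\int[mu]_x (gauss a m x)%:E = (Num.sqrt (2 * pi / a))%:E)%E.
Proof.
move=> a0; pose s := (Num.sqrt a)^-1.
have sa : 0 < Num.sqrt a by rewrite sqrtr_gt0.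
have s0 : s != 0 by rewrite invr_eq0 gt_eqF.
have s2 : s ^+ 2 = a^-1 by rewrite /s exprVn sqr_sqrtr// ltW.
have pk : normal_peak s = (Num.sqrt (2 * pi / a))^-1.
  by rewrite /normal_peak s2 -mulr_natl; congr ((Num.sqrt _)^-1); ring.
have pk0 : 0 < normal_peak s by exact: normal_peak_gt0.
have gE x : gauss a m x = (normal_peak s)^-1 * normal_pdf m s x.
  rewrite normal_pdfE// mulKf ?gt_eqF// /gauss /normal_fun s2; congr expR.
  by rewrite -(mulr_natl a^-1); field; rewrite gt_eqF.
under eq_integral do rewrite gE EFinM.
rewrite ge0_integralZl//=.
- by rewrite integral_normal_pdf mule1 pk invrK.
- by apply/measurable_EFinP; exact: measurable_normal_pdf.
- by move=> x _; rewrite lee_fin normal_pdf_ge0.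
- by rewrite lee_fin invr_ge0 ltW.
Qed.

Lemma gauss_box_le a m d : 0 < a ->
  (\int[mu]_(x in `](- d)%R, d[) (gauss a m x)%:E <= (Num.sqrt (2 * pi / a))%:E)%E.
Proof.
move=> a0; rewrite -(integral_gauss m a0); apply: ge0_subset_integral => //.
- by apply/measurable_EFinP; exact: measurable_gauss.
- by move=> x _; rewrite lee_fin expR_ge0.
Qed.

(* Outside the box [|x - m| >= e], so half of the exponent is at least [a e^2 / 4]
   and the other half is a Gaussian of doubled variance. *)
Lemma gauss_box_ge a m d e : 0 < a -> 0 <= e -> `|m| + e <= d ->
  ((Num.sqrt (2 * pi / a) * (1 - Num.sqrt 2 * expR (- (a * e ^+ 2 / 4))))%:E <=
   \int[mu]_(x in `](- d)%R, d[) (gauss a m x)%:E)%E.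
Proof.
move=> a0 e0 med.
pose B := `](- d)%R, d[%classic : set R.
have mB : measurable B by exact: measurable_itv.
have mg b : measurable_fun setT (fun x => (gauss b m x)%:E).
  by apply/measurable_EFinP; exact: measurable_gauss.
have tot : (\int[mu]_(x in B) (gauss a m x)%:E + \int[mu]_(x in ~` B) (gauss a m x)%:E
            = (Num.sqrt (2 * pi / a))%:E)%E.
  rewrite -(integral_gauss m a0) -ge0_integral_setU//= ?setUv//.
  - exact: measurableC.
  - exact: mg.
  - by move=> x _; rewrite lee_fin expR_ge0.
  - by apply/disj_setPS => x [].
have tail : (\int[mu]_(x in ~` B) (gauss a m x)%:E <=
    (expR (- (a * e ^+ 2 / 4)) * (Num.sqrt (2 * pi / a) * Num.sqrt 2))%:E)%E.
  apply: (@le_trans _ _ (\int[mu]_x ((expR (- (a * e ^+ 2 / 4)))%:E * (gauss (a / 2) m x)%:E))%E).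
    apply: (@le_trans _ _ (\int[mu]_(x in ~` B) ((expR (- (a * e ^+ 2 / 4)))%:E * (gauss (a / 2) m x)%:E))%E).
      apply: le_ge0_integral => x Bx; first by rewrite lee_fin expR_ge0.
      rewrite -EFinM lee_fin /gauss -expRD ler_expR.
      have xm : e <= `|x - m|.
        have dx : d <= `|x|.
          by rewrite leNgt; apply/negP => xd; apply: Bx; rewrite /B/= in_itv/= -ltr_norml.
        by have := ler_normD (x - m) m; rewrite subrK; lra.
      have : e ^+ 2 <= (x - m) ^+ 2.
        by rewrite -[leRHS]real_normK ?num_real// lerXn2r ?nnegrE.
      move=> h.
      have : a * e ^+ 2 <= a * (x - m) ^+ 2 by rewrite ler_wpM2l ?(ltW a0).
      by lra.
    apply: ge0_subset_integral => //.
    - exact: measurableC.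
    - by apply: measurable_funeM; exact: mg.
    - by move=> x _; rewrite -EFinM lee_fin mulr_ge0 ?expR_ge0.
  rewrite ge0_integralZl//=; last 2 first.
  - exact: mg.
  - by move=> x _; rewrite lee_fin expR_ge0.
  rewrite integral_gauss ?divr_gt0// -EFinM lee_fin.
  rewrite -sqrtrM; last by rewrite divr_ge0 ?mulr_ge0 ?pi_ge0// ltW.
  by rewrite (_ : 2 * pi / (a / 2) = 2 * pi / a * 2)//; field; rewrite gt_eqF.
rewrite -/B.
have fin : (\int[mu]_(x in B) (gauss a m x)%:E)%E \is a fin_num.
  rewrite ge0_fin_numE; last by apply: integral_ge0 => x _; rewrite lee_fin expR_ge0.
  by apply: le_lt_trans (gauss_box_le m d a0) _; rewrite ltry.
rewrite (_ : (_ * _)%:E = (Num.sqrt (2 * pi / a))%:E -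
   (expR (- (a * e ^+ 2 / 4)) * (Num.sqrt (2 * pi / a) * Num.sqrt 2))%:E)%E; last first.
  by rewrite -EFinB; congr (_%:E); ring.
rewrite leeBlDr// -tot; exact: leeD2l.
Qed.
End Gauss.

(** * Gaussian integrals over a box *)

Section IterInt.
Variables (R : realType) (L : nat).
Notation mu := (@lebesgue_measure R).
Implicit Types (th : site L -> R) (s u : seq (site L)) (f g : (site L -> R) -> \bar R).

Definition update (r : site L) (t : R) th : site L -> R :=
  fun q => if q == r then t else th q.

(** The last variable of the list is the innermost integral. Eliminating the head of [u] first
    therefore means integrating along [rev u]. *)
Lemma iter_int_rcons s r f th :
  iter_int (rcons s r) f th = iter_int s
   (fun th => (\int[mu]_(t in `[0%R, (2 * pi)%R[%classic) f (update r t th))%E) th.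
Proof. by elim: s th => //= r' s IH th; apply: eq_integral => t _; rewrite IH. Qed.

Lemma iter_int_ge0 s f th : (forall th, (0 <= f th)%E) -> (0 <= iter_int s f th)%E.
Proof. by move=> f0; elim: s th => //= r s IH th; apply: integral_ge0. Qed.

Lemma le_iter_int s f g th : (forall th, (0 <= f th)%E) ->
  (forall th, (f th <= g th)%E) -> (iter_int s f th <= iter_int s g th)%E.
Proof.
move=> f0 fg; elim: s th => //= r s IH th; apply: le_ge0_integral => // t _.
exact: iter_int_ge0.
Qed.

Variables (c d : R).
Hypotheses (c_ge0 : 0 <= c) (c_lt : c < 2 * pi) (d_le : d <= pi).

(** A Gaussian weight in the offsets, cut off to the box. The constant [k] collects the logarithms
    of the factors left by variables already integrated. *)
Definition box_gauss (A : site L -> site L -> R) u (k : R) th : \bar R :=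
  (if all (fun i => `|offset c (th i)| < d) u
   then expR (k - quad A u (fun i => offset c (th i)) / 2) else 0)%:E.

Lemma box_gauss_ge0 A u k th : (0 <= box_gauss A u k th)%E.
Proof. by rewrite lee_fin; case: ifP => // _; rewrite expR_ge0. Qed.

Lemma box_gauss_nil A k th : box_gauss A [::] k th = (expR k)%:E.
Proof. by rewrite /box_gauss /= /quad big_nil mul0r subr0. Qed.

(** After completing the square, variable [r] enters only through its own box condition and a
    Gaussian around its conditional mean, so its integral factors out. *)
Lemma box_gauss_step A r u k th : r \notin u -> 0 < A r r ->
  (forall j, j \in u -> A j r = A r j) ->
  (\int[mu]_(t in `[0%R, (2 * pi)%R[%classic) box_gauss A (r :: u) k (update r t th) =
   box_gauss (schur A r) u k th *
   \int[mu]_(x in `](- d)%R, d[) (gauss (A r r)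
      (- ((\sum_(j <- u) A r j * offset c (th j)) / A r r)) x)%:E)%E.
Proof.
move=> ru a0 sA; set m := - (_ / _).
have nr j : j \in u -> (j == r) = false by move=> ju; apply: contraNF ru => /eqP <-.
have updE t : {in u, forall j, offset c (update r t th j) = offset c (th j)}.
  by move=> j ju; rewrite /update nr.
have allE t : all (fun i => `|offset c (update r t th i)| < d) (r :: u) =
    (`|offset c t| < d) && all (fun i => `|offset c (th i)| < d) u.
  by rewrite /= {1}/update eqxx; congr (_ && _); apply: eq_in_all => j ju; rewrite updE.
have quE t : quad A (r :: u) (fun i => offset c (update r t th i)) =
    quad (schur A r) u (fun i => offset c (th i)) + A r r * (offset c t - m) ^+ 2.
  rewrite quad_schur ?gt_eqF//; congr (_ + _).
    rewrite /quad; apply: eq_big_seq => i iu; apply: eq_big_seq => j ju.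
    by rewrite !updE.
  rewrite /m opprK {1}/update eqxx; do 4 f_equal.
  by apply: eq_big_seq => j ju; rewrite updE.
pose C : R := if all (fun i => `|offset c (th i)| < d) u
  then expR (k - quad (schur A r) u (fun i => offset c (th i)) / 2) else 0.
have C0 : 0 <= C by rewrite /C; case: ifP => // _; rewrite expR_ge0.
rewrite -(integral_offset c_ge0 c_lt d_le (measurable_gauss (A r r) m)).
rewrite /box_gauss -/C -ge0_integralZl//=.
- apply: eq_integral => t _; rewrite -EFinM; congr (_%:E).
  have := allE t; rewrite /= => ->; rewrite /C.
  case: (all _ u); rewrite ?andbT ?andbF ?mul0r//.
  case: ifP => _; rewrite ?mulr0// quE /gauss -expRD; congr expR; ring.
- apply/measurable_EFinP.
  apply: (@measurable_funS _ _ _ _ setT) => //.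
  apply: measurable_fun_ifT => //.
  + apply: measurable_fun_ltr => //; apply: measurableT_comp => //.
    exact: measurable_offset.
  + apply: measurableT_comp; [exact: measurable_gauss|exact: measurable_offset].
- by move=> t _; rewrite lee_fin; case: ifP => // _; rewrite expR_ge0.
Qed.

Lemma sqrt_expR_ln (y : R) : 0 < y -> Num.sqrt y = expR (ln y / 2).
Proof.
move=> y0; rewrite -[X in Num.sqrt X](lnK y0) [in LHS](splitr (ln y)) expRD -expr2.
by rewrite sqrtr_sqr ger0_norm ?expR_ge0.
Qed.

(** Each integral is extended to the whole line and contributes [sqrt (2 pi / A r r)]. The product
    of the successive pivots [A r r] is the determinant. *)
Lemma box_gauss_iter_le lam K A u k th : 0 < lam -> uniq u -> dominant lam K A u ->
  (iter_int (rev u) (box_gauss A u k) th <=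
   (expR (k + ((size u)%:R * ln (2 * pi) - ln (\det (seq_mx A u))) / 2))%:E)%E.
Proof.
move=> l0; elim: u A k th => [|r u IH] A k th uu dA.
  by rewrite /= box_gauss_nil det_mx00 ln1 mul0r subr0 mul0r addr0.
have /andP[ge_l _] := dominant_diag uu dA.
have a0 : 0 < A r r by lra.
have dS := dominant_schur l0 uu dA.
have := uu => /= /andP[ru uu'].
have D0 := det_dominant_gt0 l0 uu' dS.
rewrite rev_cons iter_int_rcons.
apply: le_trans (le_iter_int (g := box_gauss (schur A r) u (k + ln (2 * pi / A r r) / 2)) _ _ _ _) _.
- by move=> th'; apply: integral_ge0 => t _; exact: box_gauss_ge0.
- move=> th'; rewrite box_gauss_step//; last first.
    by move=> j ju; case: dA => sA _ _ _; apply: sA; rewrite inE ?eqxx ?ju ?orbT.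
  apply: le_trans (lee_wpmul2l (box_gauss_ge0 _ _ _ _) (gauss_box_le _ _ a0)) _.
  rewrite sqrt_expR_ln; last by rewrite divr_gt0// twopi_gt0.
  rewrite /box_gauss -EFinM lee_fin; case: ifP => _; last by rewrite mul0r.
  by rewrite -expRD ler_expR; lra.
apply: le_trans (IH _ _ _ uu' dS) _.
rewrite lee_fin ler_expR det_schur ?gt_eqF// [ln (A r r * _)]lnM ?posrE//
  ln_div ?posrE ?twopi_gt0//.
by rewrite /= -[(size u).+1%:R]natr1; lra.
Qed.

(** When the other offsets are in the box, the conditional mean keeps away from its boundary, so
    that each integration loses at most a factor [1 - eta] against the full Gaussian integral. *)
Lemma box_gauss_iter_ge lam K A u k th eta : 0 < lam -> 0 < d -> uniq u ->
  dominant lam K A u ->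
  eta = Num.sqrt 2 * expR (- (lam ^+ 2 * d ^+ 2 / (4 * K))) -> eta < 1 ->
  ((expR (k + ((size u)%:R * ln (2 * pi) - ln (\det (seq_mx A u))) / 2
     + (size u)%:R * ln (1 - eta)))%:E <= iter_int (rev u) (box_gauss A u k) th)%E.
Proof.
move=> l0 d0 + + etaE eta1; elim: u A k th => [|r u IH] A k th uu dA.
  by rewrite /= box_gauss_nil det_mx00 ln1 !mul0r subr0 mul0r !addr0.
have /andP[ge_l le_K] := dominant_diag uu dA.
have a0 : 0 < A r r by lra.
have dS := dominant_schur l0 uu dA.
have off := dominant_offdiag uu dA.
have := uu => /= /andP[ru uu'].
have D0 := det_dominant_gt0 l0 uu' dS.
rewrite rev_cons iter_int_rcons.
apply: le_trans (le_iter_int (f := box_gauss (schur A r) u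
  (k + ln (2 * pi / A r r) / 2 + ln (1 - eta))) _ _ _ _); last 2 first.
- by move=> th'; exact: box_gauss_ge0.
- move=> th'; rewrite box_gauss_step//; last first.
    by move=> j ju; case: dA => sA _ _ _; apply: sA; rewrite inE ?eqxx ?ju ?orbT.
  set S := \sum_(j <- u) _.
  rewrite /box_gauss; case: ifPn => [/allP inbox|_]; last by rewrite mul0e.
  (* This is exactly the room left by [dominant_offdiag], since the mean is at most [d - e] in
     absolute value. *)
  pose e := lam * d / A r r.
  have e0 : 0 <= e by rewrite /e divr_ge0 ?mulr_ge0 ?ltW.
  have S_le : `|S| <= (A r r - lam) * d.
    apply: le_trans (ler_norm_sum _ _ _) _.
    apply: (@le_trans _ _ ((\sum_(j <- u) `|A r j|) * d)); last by rewrite ler_wpM2r ?(ltW d0).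
    rewrite mulr_suml big_seq [leRHS]big_seq; apply: ler_sum => j ju.
    by rewrite normrM ler_wpM2l// ltW// inbox.
  have med : `|- (S / A r r)| + e <= d.
    rewrite normrN normrM normfV (gtr0_norm a0) /e -mulrDl ler_pdivrMr//; lra.
  apply: le_trans (lee_wpmul2l _ (gauss_box_ge a0 e0 med)); last by rewrite lee_fin expR_ge0.
  rewrite sqrt_expR_ln; last by rewrite divr_gt0// twopi_gt0.
  rewrite -EFinM lee_fin.
  rewrite (_ : k + _ + _ - _ = (k - quad (schur A r) u (fun i => offset c (th' i)) / 2)
     + (ln (2 * pi / A r r) / 2 + ln (1 - eta))); last by ring.
  rewrite [leLHS]expRD ler_wpM2l ?expR_ge0// [leLHS]expRD ler_wpM2l ?expR_ge0//.
  rewrite lnK ?posrE ?subr_gt0// lerD2l lerN2 etaE ler_wpM2l ?sqrtr_ge0// ler_expR lerN2.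
  (* The pivot ends up in the denominator, so its upper bound [K] gives one [eta] for all
     variables. *)
  have -> : A r r * e ^+ 2 / 4 = lam ^+ 2 * d ^+ 2 / (4 * A r r).
    by rewrite /e; field; rewrite gt_eqF.
  apply: ler_wpM2l; first by rewrite mulr_ge0 ?sqr_ge0.
  by rewrite lef_pV2 ?posrE; lra.
apply: le_trans (IH _ _ _ uu' dS).
rewrite lee_fin ler_expR det_schur ?gt_eqF// [ln (A r r * _)]lnM ?posrE//
  ln_div ?posrE ?twopi_gt0//.
by rewrite /= -[(size u).+1%:R]natr1; lra.
Qed.
End IterInt.

(** * Comparison with the spin-wave energy *)

Section Trig.
Variable R : realType.
Implicit Types (a x y d : R).

Lemma sin_lipschitz x y : `|sin x - sin y| <= `|x - y|.
Proof.
wlog xy : x y / y <= x => [H|].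
  by case/orP: (le_total y x) => /H//; rewrite distrC (distrC x).
have [|z _ ->] := @MVT_segment R sin cos y x xy.
  by apply: continuous_subspaceT; exact: continuous_sin.
by rewrite normrM ler_piMl// cos_max.
Qed.

(** The intermediate point is recorded as [a + z] with [z] in the box, ready for comparing its sine
    with [sin a]. *)
Lemma cos_mean_value a x y d : `|x| < d -> `|y| < d ->
  exists2 z, `|z| <= d & cos (a + x) - cos (a + y) = - sin (a + z) * (x - y).
Proof.
wlog xy : x y / y <= x => [H xd yd|].
  case/orP: (le_total y x) => h; first exact: H.
  have [z zd E] := H y x h yd xd; exists z => //.
  by rewrite -opprB E; ring.
rewrite !ltr_norml => /andP[x1 x2] /andP[y1 y2].
have [||z] := @MVT_segment R cos (fun t => - sin t) (a + y) (a + x).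
- by rewrite lerD2l.
- by apply: continuous_subspaceT; exact: continuous_cos.
rewrite in_itv/= => /andP[z1 z2] E; exists (z - a); last by rewrite E subrKC; ring.
by rewrite ler_norml; apply/andP; split; lra.
Qed.

(** After the mean value theorem the difference of squares factors. The difference of the sines is
    at most [d], their sum at most 2, and [(x - y)^2] at most [4 d^2]. *)
Lemma cos_diff_sqr a x y d : `|x| < d -> `|y| < d ->
  `|(cos (a + x) - cos (a + y)) ^+ 2 - sin a ^+ 2 * (x - y) ^+ 2| <= 8 * d ^+ 3.
Proof.
move=> xd yd; have [z zd ->] := cos_mean_value a xd yd.
have -> : (- sin (a + z) * (x - y)) ^+ 2 - sin a ^+ 2 * (x - y) ^+ 2 =
  (sin (a + z) - sin a) * (sin (a + z) + sin a) * (x - y) ^+ 2 by ring.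
rewrite normrM normrM.
have h1 : `|sin (a + z) - sin a| <= d.
  by apply: le_trans (sin_lipschitz _ _) _; rewrite addrAC subrr add0r.
have h2 : `|sin (a + z) + sin a| <= 2.
  by apply: le_trans (ler_normD _ _) _; have := sin_max (a + z); have := sin_max a; lra.
have h3 : `|(x - y) ^+ 2| <= 4 * d ^+ 2.
  rewrite normrX (_ : 4 * d ^+ 2 = (2 * d) ^+ 2); last by ring.
  rewrite lerXn2r ?nnegrE//; first by have := normr_ge0 x; lra.
  by apply: le_trans (ler_normB _ _) _; lra.
have -> : 8 * d ^+ 3 = d * 2 * (4 * d ^+ 2) by ring.
by apply: ler_pM => //; exact: ler_pM.
Qed.
End Trig.

(** * The energy and its quadratic approximation *)

Section Hamiltonian.
Variables (R : realType) (L : nat).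
Implicit Types (th : site L -> R) (c d lam b J beta : R).

Definition weight1 c : R := sin c ^+ 2.
Definition weight2 c : R := sin (c - 2 * pi / 3) ^+ 2.
Definition weight3 c : R := sin (c + 2 * pi / 3) ^+ 2.

Definition spinwave c (x : site L -> R) : R :=
  \sum_r (weight1 c * (x r - x (shift1 r)) ^+ 2
    + weight2 c * (x r - x (shift2 r)) ^+ 2 + weight3 c * (x r - x (shift3 r)) ^+ 2).

Lemma card_site : #|{: site L}| = (L ^ 3)%N.
Proof. by rewrite !card_prod card_ord !expnS expn0 muln1 mulnA. Qed.

(** Three directions with error [8 d^3] each, multiplied by [beta J / 2], give the constant 12 per
    site. *)
Lemma hamiltonian_spinwave J beta c d th : 0 < J -> 0 < beta ->
  (forall r, `|offset c (th r)| < d) ->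
  `|beta * hamiltonian J th - beta * J / 2 * spinwave c (fun r => offset c (th r))|
  <= 12 * (beta * J * d ^+ 3) * (L ^ 3)%:R.
Proof.
move=> J0 b0 inb; rewrite /hamiltonian /spinwave mulrA [beta * (J / 2)]mulrA -mulrBr -sumrB.
have bJ : 0 < beta * J / 2 by rewrite divr_gt0// mulr_gt0.
rewrite normrM (gtr0_norm bJ).
have -> : 12 * (beta * J * d ^+ 3) * (L ^ 3)%:R =
    beta * J / 2 * \sum_(r : site L) (24 * d ^+ 3).
  by rewrite sumr_const card_site -mulr_natr; field.
rewrite ler_wpM2l ?(ltW bJ)//; apply: le_trans (ler_norm_sum _ _ _) _.
apply: ler_sum => r _.
have h a s : `|(cos (th r + a) - cos (th s + a)) ^+ 2
   - sin (c + a) ^+ 2 * (offset c (th r) - offset c (th s)) ^+ 2| <= 8 * d ^+ 3.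
  rewrite (cos_offset c (th r)) (cos_offset c (th s)).
  rewrite (addrAC c _ a) (addrAC c (offset c (th s)) a).
  exact: cos_diff_sqr.
have h1 := h 0 (shift1 r); have h2 := h (- (2 * pi / 3)) (shift2 r).
have h3 := h (2 * pi / 3) (shift3 r).
rewrite !addr0 -/(weight1 c) in h1.
rewrite -/(weight2 c) in h2; rewrite -/(weight3 c) in h3.
set A1 := (_ - _) ^+ 2 in h1 *; set A2 := (_ - _) ^+ 2 in h2 *.
set A3 := (_ - _) ^+ 2 in h3 *.
rewrite (_ : _ - _ = (A1 - weight1 c * (offset c (th r) - offset c (th (shift1 r))) ^+ 2)
  + (A2 - weight2 c * (offset c (th r) - offset c (th (shift2 r))) ^+ 2)
  + (A3 - weight3 c * (offset c (th r) - offset c (th (shift3 r))) ^+ 2)); last by ring.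
apply: le_trans (ler_normD _ _) _; have := ler_normD
  (A1 - weight1 c * (offset c (th r) - offset c (th (shift1 r))) ^+ 2)
  (A2 - weight2 c * (offset c (th r) - offset c (th (shift2 r))) ^+ 2).
by lra.
Qed.

(** The cross terms cancel for three directions spaced by [2 pi / 3]. The identity bounds the
    diagonal of [torus_mx] and forces one of the weights to be at least [1 / 2]. *)
Lemma weight_sum c : weight1 c + weight2 c + weight3 c = 3 / 2.
Proof.
rewrite /weight1 /weight2 /weight3.
(* The value comes from expanding [sin (3 x) = 0] at [x = pi / 3]: as [sin x] is nonzero,
   [4 cos(x)^2 = 1]. *)
have c23 : cos (2 * pi / 3) = - (1 / 2) :> R.
  have s0 : 0 < sin (pi / 3) :> R.
    by rewrite sin_gt0_pi//; have := @pi_gt0 R => ?; apply/andP; split; lra.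
  have : sin (2 * pi / 3 + pi / 3) = 0 :> R.
    by rewrite (_ : 2 * pi / 3 + pi / 3 = pi) ?sinpi//; field.
  rewrite (_ : 2 * pi / 3 = pi / 3 + pi / 3) in |- *; last by field.
  have := cos2Dsin2 (pi / 3 : R).
  rewrite !sinD !cosD; set s := sin _ in s0 *; set k := cos _ => h1 h2.
  have h3 : s * (4 * k ^+ 2 - 1) = 0.
    have -> : s * (4 * k ^+ 2 - 1) = s * (4 * k ^+ 2 - (k ^+ 2 + s ^+ 2)) by rewrite h1.
    by rewrite -h2; ring.
  move/eqP: h3; rewrite mulf_eq0 gt_eqF//= subr_eq0 => /eqP h3.
  have -> : k * k - s * s = 2 * k ^+ 2 - (k ^+ 2 + s ^+ 2) by ring.
  by rewrite h1; lra.
have s23 : sin (2 * pi / 3) ^+ 2 = 3 / 4 :> R.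
  by rewrite sin2cos2 c23; field.
rewrite sinB sinD c23.
have -> : sin c ^+ 2 + (sin c * - (1 / 2) - cos c * sin (2 * pi / 3)) ^+ 2 +
   (sin c * - (1 / 2) + cos c * sin (2 * pi / 3)) ^+ 2 =
   3 / 2 * sin c ^+ 2 + 2 * cos c ^+ 2 * sin (2 * pi / 3) ^+ 2 by field.
by rewrite s23; have := cos2Dsin2 c => h; lra.
Qed.
End Hamiltonian.

(** * Two-sided bounds on the free energy in finite volume *)

Section FreeEnergyBounds.
Variables (R : realType) (L : nat) (J beta d c : R).
Hypotheses (L0 : (0 < L)%N) (J0 : 0 < J) (beta0 : 0 < beta) (d0 : 0 < d) (d1 : d < 1).
Hypotheses (c_ge0 : 0 <= c) (c_lt : c < 2 * pi).
Implicit Types (th : site L -> R) (lam : R).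

Let b := beta * J.
Let N : R := (L ^ 3)%:R.
Let q1 := weight1 c. Let q2 := weight2 c. Let q3 := weight3 c.

Definition massive (lam x y z : R) := ln (lam + dispersion q1 q2 q3 x y z).

Definition lattice_avg lam : R := N^-1 *
  \sum_(k : site L) massive lam (freq R k.1.1) (freq R k.1.2) (freq R k.2).

Let b_gt0 : 0 < b. Proof. exact: mulr_gt0. Qed.
Let N_gt0 : 0 < N. Proof. by rewrite ltr0n expn_gt0 L0. Qed.
Let d_le : d <= pi. Proof. by apply: le_trans (ltW d1) _; apply: le_trans (@pi_ge2 R); lra. Qed.
Let q1_ge0 : 0 <= q1. Proof. exact: sqr_ge0. Qed.
Let q2_ge0 : 0 <= q2. Proof. exact: sqr_ge0. Qed.
Let q3_ge0 : 0 <= q3. Proof. exact: sqr_ge0. Qed.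

Lemma dispersion_ge0 (x y z : R) : 0 <= dispersion q1 q2 q3 x y z.
Proof.
have h (t : R) : 0 <= 2 - 2 * cos t by have := cos_le1 t; lra.
by rewrite /dispersion; apply: addr_ge0; [apply: addr_ge0|]; exact: mulr_ge0.
Qed.

(** Reversed, so that [rev u] is the order of integration in [partition_fn]. *)
Let u := rev (enum [set: site L]).
Let uu : uniq u. Proof. by rewrite rev_uniq enum_uniq. Qed.
Let inu r : r \in u. Proof. by rewrite mem_rev mem_enum in_setT. Qed.
Let size_u : size u = (L ^ 3)%N.
Proof.
rewrite size_rev -cardE -card_site; apply: eq_card => r.
by rewrite in_setT.
Qed.

Let weightf th : \bar R := (expR (- (beta * hamiltonian J th)) * chi d c th)%:E.

Let partitionE : partition_fn J beta d c L = iter_int (rev u) weightf (fun=> 0).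
Proof. by rewrite /u revK. Qed.

Let chiE th : chi d c th = (all (fun i => `|offset c (th i)| < d) u)%:R.
Proof.
rewrite /chi; case: asboolP => h.
- by rewrite (_ : all _ _) //; apply/allP => r _; apply/angle_closeE.
- rewrite (_ : all _ _ = false) //; apply/negP => /allP h'; apply: h => r.
  by apply/(angle_closeE _ _ d_le); exact: h'.
Qed.

Let torus lam := @torus_mx R L q1 q2 q3 lam b.

Let torus_dom lam : dominant (b * lam) (b * (lam + 3)) (torus lam) u.
Proof.
have -> : lam + 3 = lam + 2 * (q1 + q2 + q3) by rewrite weight_sum; field.
exact: torus_mx_dominant.
Qed.

Let ln_det lam : 0 < lam ->
  ln (\det (seq_mx (torus lam) u)) = N * (ln b + lattice_avg lam).
Proof.
move=> l0; rewrite torus_mx_det// /lattice_avg mulrDr mulVKf ?gt_eqF//.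
have pos (k : site L) : 0 < lam + dispersion q1 q2 q3 (freq R k.1.1) (freq R k.1.2) (freq R k.2).
  by have := dispersion_ge0 (freq R k.1.1) (freq R k.1.2) (freq R k.2); lra.
have -> : N * ln b = \sum_(k : site L) ln b.
  by rewrite sumr_const card_site -mulr_natl.
rewrite -big_split /=.
have -> : forall F : site L -> R, (forall k, 0 < F k) ->
    ln (\prod_k F k) = \sum_k ln (F k).
  move=> F F0; suff [] : 0 < \prod_k F k /\ ln (\prod_k F k) = \sum_k ln (F k) by [].
  apply: (big_ind2 (fun x y => 0 < x /\ ln x = y)) => //.
  - by rewrite ln1.
  - move=> x1 x2 y1 y2 [x10 <-] [x20 <-]; split; first exact: mulr_gt0.
    by rewrite lnM.
- by apply: eq_bigr => k _; rewrite lnM ?posrE ?pos //.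
- by move=> k; rewrite mulr_gt0.
Qed.

Let quadE lam th : quad (torus lam) u (fun i => offset c (th i)) =
  b * (lam * \sum_r offset c (th r) ^+ 2 + spinwave c (fun r => offset c (th r))).
Proof. exact: torus_mx_quad. Qed.

Let sumsq_ge0 th : 0 <= \sum_r offset c (th r) ^+ 2.
Proof. by apply: sumr_ge0 => r _; exact: sqr_ge0. Qed.

Let err := 12 * (b * d ^+ 3).

(** The mass term lowers the Gaussian weight; on the box it is at most [b lam d^2 / 2] per site, and
    this is given back in the constant. *)
Let weightf_le lam th : 0 < lam ->
  (weightf th <= box_gauss c d (torus lam) u ((err + b * lam * d ^+ 2 / 2) * N) th)%E.
Proof.
move=> l0; rewrite /weightf /box_gauss chiE lee_fin; case: ifPn => [/allP h|_]; last by rewrite mulr0.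
have inb r : `|offset c (th r)| < d by exact: h.
rewrite mulr1 ler_expR quadE.
have := hamiltonian_spinwave J0 beta0 inb; rewrite -/b -/N -/err ler_norml => /andP[h1 _].
have : \sum_r offset c (th r) ^+ 2 <= d ^+ 2 * N.
  rewrite mulr_natr -card_site -sumr_const; apply: ler_sum => r _.
  by rewrite -real_normK ?num_real// lerXn2r ?nnegrE// ltW.
move=> h2.
have : b * lam * \sum_r offset c (th r) ^+ 2 <= b * lam * (d ^+ 2 * N).
  by rewrite ler_wpM2l// mulr_ge0// ltW.
by lra.
Qed.

(** In this direction the mass term has the favourable sign and costs nothing. *)
Let weightf_ge lam th : 0 < lam ->
  (box_gauss c d (torus lam) u (- (err * N)) th <= weightf th)%E.
Proof.
move=> l0; rewrite /weightf /box_gauss chiE lee_fin; case: ifPn => [/allP h|_]; last by rewrite mulr0.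
have inb r : `|offset c (th r)| < d by exact: h.
rewrite mulr1 ler_expR quadE.
have := hamiltonian_spinwave J0 beta0 inb; rewrite -/b -/N -/err ler_norml => /andP[_ h1].
have : 0 <= b * lam * \sum_r offset c (th r) ^+ 2.
  by rewrite !mulr_ge0// ltW.
by lra.
Qed.

Let weightf_ge0 th : (0 <= weightf th)%E.
Proof. by rewrite lee_fin chiE mulr_ge0 ?expR_ge0. Qed.

Let upper lam : 0 < lam -> (partition_fn J beta d c L <=
  (expR (N * (err + b * lam * d ^+ 2 / 2 + (ln (2 * pi) - ln b - lattice_avg lam) / 2)))%:E)%E.
Proof.
move=> l0; rewrite partitionE.
apply: le_trans (le_iter_int _ _ weightf_ge0 (fun th => weightf_le th l0)) _.
apply: le_trans (box_gauss_iter_le c_ge0 c_lt d_le _ _ _ uu (torus_dom lam)) _.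
  exact: mulr_gt0.
by rewrite lee_fin ler_expR ln_det// size_u -/N; lra.
Qed.

(** The loss [eta] of [box_gauss_iter_ge] for row sums [b lam] and diagonal bound [b (lam + 3)]. It
    depends on [b] and [d] only through [b d^2]. *)
Definition escape lam : R := Num.sqrt 2 * expR (- (lam ^+ 2 * (b * d ^+ 2) / (4 * (lam + 3)))).

Let lower lam : 0 < lam -> escape lam < 1 ->
  ((expR (N * (ln (1 - escape lam) - err + (ln (2 * pi) - ln b - lattice_avg lam) / 2)))%:E
   <= partition_fn J beta d c L)%E.
Proof.
move=> l0 e1; rewrite partitionE.
apply: le_trans (le_iter_int _ _ _ (fun th => weightf_ge th l0)); last first.
  by move=> th; exact: box_gauss_ge0.
apply: le_trans (box_gauss_iter_ge c_ge0 c_lt d_le _ _ _ d0 uu (torus_dom lam) _ e1).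
- by rewrite lee_fin ler_expR ln_det// size_u -/N; lra.
- exact: mulr_gt0.
- rewrite /escape; congr (_ * expR (- _)); field.
  by rewrite !gt_eqF//; lra.
Qed.

(** The two bounds make the partition function finite and positive, so [fine] and [ln] in [F_Delta]
    do not take default values. *)
Let ZE lam : 0 < lam -> escape lam < 1 -> exists2 z, partition_fn J beta d c L = (expR z)%:E &
  F_Delta J beta d L c = - (1 / 2) * (ln b - ln (2 * pi)) - N^-1 * z.
Proof.
move=> l0 e1; have hu := upper l0; have hl := lower l0 e1.
rewrite /F_Delta ln_div ?posrE ?twopi_gt0// -/b -/N.
case: (partition_fn J beta d c L) hu hl => [z| |] //=; rewrite !lee_fin => hu hl.
have z0 : 0 < z by apply: lt_le_trans hl; exact: expR_gt0.
by exists (ln z) => //; rewrite lnK.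
Qed.

Let F_DeltaE lam : 0 < lam -> escape lam < 1 ->
  exists2 z, partition_fn J beta d c L = (expR (N * z))%:E &
  F_Delta J beta d L c = (ln (2 * pi) - ln b) / 2 - z.
Proof.
move=> l0 e1; have [z -> ->] := ZE l0 e1; exists (N^-1 * z); last by set w := N^-1 * z; field.
by rewrite mulVKf ?gt_eqF.
Qed.

Lemma F_Delta_le lam : 0 < lam -> escape lam < 1 ->
  F_Delta J beta d L c <=
  lattice_avg lam / 2 + 12 * (beta * J * d ^+ 3) - ln (1 - escape lam).
Proof.
move=> l0 e1; have [z Zz ->] := F_DeltaE l0 e1.
have := lower l0 e1; rewrite Zz lee_fin ler_expR ler_pM2l// /err /b => h.
by lra.
Qed.

(** Two masses: [lam0] guarantees that the partition function is positive, which leaves [lam] free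
    to be so small that [b lam d^2] is negligible. *)
Lemma F_Delta_ge lam lam0 : 0 < lam -> 0 < lam0 -> escape lam0 < 1 ->
  lattice_avg lam / 2 - 12 * (beta * J * d ^+ 3) - beta * J * lam * d ^+ 2 / 2 <=
  F_Delta J beta d L c.
Proof.
move=> l0 l00 e1; have [z Zz ->] := F_DeltaE l00 e1.
have := upper l0; rewrite Zz lee_fin ler_expR ler_pM2l// /err /b => h.
by lra.
Qed.
End FreeEnergyBounds.

(** * Riemann sums on the torus *)

Lemma integrable_bounded (R : realType) (d : measure_display) (T : measurableType d)
    (m : {measure set T -> \bar R}) (A : set T) (f : T -> R) (M : R) :
  measurable A -> (m A < +oo)%E -> measurable_fun A f ->
  (forall x, A x -> `|f x| <= M) -> m.-integrable A (EFin \o f).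
Proof.
move=> mA fA mf fM; apply: measurable_bounded_integrable => //.
exists M; split; first exact: num_real.
by move=> y My x Ax /=; apply: le_trans (fM x Ax) (ltW My).
Qed.

Section Riemann.
Variable R : realType.
Notation mu := (@lebesgue_measure R).
Implicit Types (f : R -> R) (K M : R).

(** This class is preserved, with the same constants, by averaging a function of several variables
    over one of them. *)
Definition tame K M f :=
  [/\ forall x y, `|f x - f y| <= K * `|x - y|,
      forall x, f (x + 2 * pi) = f x & forall x, `|f x| <= M].

Lemma lipschitz_continuous K f :
  (forall x y, `|f x - f y| <= K * `|x - y|) -> continuous f.
Proof.
move=> fK x; apply/cvgrPdist_le => e e0.
have K0 : 0 < `|K| + 1 by rewrite ltr_wpDl.
apply/nbhs_ballP; exists (e / (`|K| + 1)); first by rewrite /= divr_gt0.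
move=> t; rewrite /ball /= ltr_pdivlMr// => xt.
apply: le_trans (fK _ _) _; apply: le_trans (ltW xt).
by rewrite mulrC ler_wpM2l//; have := ler_norm K; lra.
Qed.

Lemma tame_measurable K M f : tame K M f -> measurable_fun setT f.
Proof. by case=> /lipschitz_continuous cf _ _; exact: continuous_measurable_fun. Qed.

Lemma lebesgue_measure_itv_fin (a b : R) (s t : bool) :
  (mu [set` Interval (BSide s a) (BSide t b)] < +oo)%E.
Proof. by rewrite lebesgue_measure_itv/=; case: ifP => // _; rewrite -EFinB ltry. Qed.

Lemma tame_integrable K M f a b (s t : bool) : tame K M f ->
  mu.-integrable [set` Interval (BSide s a) (BSide t b)] (EFin \o f).
Proof.
move=> tf; case: (tf) => _ _ fM.
apply: (@integrable_bounded R _ _ mu _ f M) => //.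
- exact: lebesgue_measure_itv_fin.
- by apply: measurable_funTS; exact: tame_measurable tf.
Qed.

Definition circle_avg f : R := (2 * pi)^-1 * \int[mu]_(x in `[- pi, pi]) f x.

Lemma Rintegral_cell K M f a h : tame K M f -> 0 <= h ->
  `|\int[mu]_(x in `[a, a + h[) f x - h * f a| <= K * h * h.
Proof.
move=> tf h0; case: (tf) => fK _ fM.
have mh : fine (mu `[a, a + h[%classic) = h.
  rewrite lebesgue_measure_itv/= lte_fin ltrDl; case: ltP => hh.
    by rewrite -EFinB/=; ring.
  by rewrite /=; lra.
have mA : measurable (`[a, a + h[%classic : set R) by exact: measurable_itv.
have tc (r : R) : mu.-integrable `[a, a + h[ (EFin \o cst r).
  apply: (@integrable_bounded _ _ _ _ _ _ `|r|) => //.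
  exact: lebesgue_measure_itv_fin.
have -> : h * f a = \int[mu]_(x in `[a, a + h[) (cst (f a)) x.
  by rewrite /= Rintegral_cst// mh mulrC.
have If := tame_integrable a (a + h) true true tf.
rewrite -RintegralB; [|exact: mA|exact: If|exact: tc].
have iB : mu.-integrable `[a, a + h[ (EFin \o (fun x => f x - cst (f a) x)).
  by rewrite (_ : _ \o _ = (fun x => (EFin \o f) x - (EFin \o cst (f a)) x)%E) //; exact: integrableB.
apply: le_trans (le_normr_Rintegral _ iB) _ => //.
have -> : K * h * h = \int[mu]_(x in `[a, a + h[) (cst (K * h)) x.
  by rewrite /= Rintegral_cst// mh.
apply: le_Rintegral => //.
  exact: integrable_norm.
move=> x /=; rewrite in_itv/= => /andP[ax xh].
apply: le_trans (fK _ _) _.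
have K0 : 0 <= K.
  have := fK 1 0; rewrite subr0 normr1 mulr1; exact: le_trans (normr_ge0 _).
by rewrite ler_wpM2l// ger0_norm ?subr_ge0//; lra.
Qed.

Lemma Rintegral_cut K M f x y z : tame K M f -> x <= y -> y <= z ->
  \int[mu]_(t in `[x, z[) f t = \int[mu]_(t in `[x, y[) f t + \int[mu]_(t in `[y, z[) f t.
Proof.
move=> tf xy yz.
have E : `[x, z[%classic = `[x, y[%classic `|` `[y, z[%classic :> set R.
  by rewrite -itv_bndbnd_setU//= ?bnd_simp//.
rewrite E Rintegral_setU//; first by rewrite -E; exact: tame_integrable tf.
apply/disj_setPS => t [] /=; rewrite !in_itv/= => /andP[_ ty] /andP[yt _].
by have := lt_le_trans ty yt; rewrite ltxx.
Qed.

(** The frequencies lie in [[0, 2 pi[] while the spin-wave integral runs over [[- pi, pi]];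
    periodicity reconciles the two. *)
Lemma circle_avgE K M f : tame K M f ->
  circle_avg f = (2 * pi)^-1 * \int[mu]_(x in `[0, 2 * pi[) f x.
Proof.
move=> tf; congr (_ * _); rewrite /Rintegral; congr fine.
have mf : measurable_fun setT (fun x => (f x)%:E).
  by apply/measurable_EFinP; exact: tame_measurable tf.
rewrite -integral_itv_bndo_bndc//; last exact: measurable_funTS.
have pp := @pi_gt0 R.
have e : - pi + 2 * pi = pi :> R by ring.
have := @integral_period R (2 * pi) (- pi) 0 (fun x => (f x)%:E) mf.
rewrite e add0r; apply; [|lra|lra].
by case: tf => _ per _ x; rewrite per.
Qed.

(** Each of the [L] cells has length [h = 2 pi / L] and error at most [K h^2]; the sum of these is
    then divided by [2 pi]. *)
Lemma circle_avg_riemann K M f L : tame K M f -> (0 < L)%N ->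
  `|L%:R^-1 * \sum_(j < L) f (freq R j) - circle_avg f| <= 2 * pi * K / L%:R.
Proof.
move=> tf L0; have pp := @pi_gt0 R.
have l0 : 0 < L%:R :> R by rewrite ltr0n.
pose h : R := 2 * pi / L%:R.
have h0 : 0 < h by rewrite divr_gt0//; lra.
have key n : `|\int[mu]_(x in `[0, n%:R * h[) f x - h * \sum_(j < n) f (j%:R * h)| <= n%:R * (K * h * h).
  elim: n => [|n IH].
    by rewrite mul0r set_itv_ge ?bnd_simp ?ltxx// Rintegral_set0 big_ord0 mulr0 subrr normr0 mul0r.
  rewrite (@Rintegral_cut _ _ _ _ (n%:R * h) _ tf); last 2 first.
  - by rewrite mulr_ge0 ?ler0n ?(ltW h0).
  - by rewrite ler_wpM2r ?(ltW h0)// ler_nat.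
  have -> : n.+1%:R * h = n%:R * h + h by rewrite -natr1; ring.
  have := Rintegral_cell (n%:R * h) tf (ltW h0).
  rewrite big_ord_recr /= mulrDr -[n.+1%:R]natr1.
  set I1 := \int[mu]_(x in `[0, _[) _ in IH *.
  set I2 := \int[mu]_(x in _) _; set S := \sum_(j < n) _ in IH * => I2h.
  have -> : I1 + I2 - (h * S + h * f (n%:R * h)) = (I1 - h * S) + (I2 - h * f (n%:R * h)) by ring.
  by apply: le_trans (ler_normD _ _) _; lra.
rewrite (circle_avgE tf).
have := key L; rewrite (_ : L%:R * h = 2 * pi); last by rewrite /h; field; rewrite gt_eqF.
have -> : \sum_(j < L) f (freq R j) = \sum_(j < L) f (j%:R * h).
  by apply: eq_bigr => j _; congr f; rewrite /freq /h; ring.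
set I := \int[mu]_(x in _) _; set S := \sum_(j < L) _ => k.
have -> : L%:R^-1 * S - (2 * pi)^-1 * I = - (2 * pi)^-1 * (I - h * S).
  rewrite /h; move: (pi : R) (L%:R : R) pp l0 => p l pp l0.
  by field; rewrite !gt_eqF.
have p2 : 0 < (2 * pi)^-1 :> R by rewrite invr_gt0; lra.
rewrite normrM normrN (gtr0_norm p2).
have -> : 2 * pi * K / L%:R = (2 * pi)^-1 * (L%:R * (K * h * h)).
  rewrite /h; move: (pi : R) (L%:R : R) pp l0 => p l pp l0.
  by field; rewrite !gt_eqF.
by rewrite ler_wpM2l ?(ltW p2).
Qed.

Lemma circle_avg_lipschitz K M (f g : R -> R) e :
  tame K M f -> tame K M g -> (forall x, `|f x - g x| <= e) ->
  `|circle_avg f - circle_avg g| <= e.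
Proof.
move=> tf tg fg; have pp := @pi_gt0 R.
have p2 : 0 < (2 * pi)^-1 :> R by rewrite invr_gt0; lra.
have If := tame_integrable (- pi) pi true false tf.
have Ig := tame_integrable (- pi) pi true false tg.
rewrite /circle_avg -mulrBr -RintegralB// normrM (gtr0_norm p2).
have iB : mu.-integrable `[- pi, pi] (EFin \o (fun x => f x - g x)).
  by rewrite (_ : _ \o _ = (fun x => (EFin \o f) x - (EFin \o g) x)%E) //; exact: integrableB.
rewrite ler_pdivrMl; last lra.
have mI : fine (mu `[- pi, pi]%classic) = 2 * pi.
  by rewrite lebesgue_measure_itv/= lte_fin ifT -?EFinB /=; [ring|lra].
have -> : 2 * pi * e = \int[mu]_(x in `[- pi, pi]) (cst e) x.
  by rewrite /= Rintegral_cst// mI mulrC.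
apply: le_trans (le_normr_Rintegral _ iB) _ => //.
apply: le_Rintegral => //.
- exact: integrable_norm.
- apply: (@integrable_bounded _ _ _ _ _ _ `|e|) => //.
  exact: lebesgue_measure_itv_fin.
Qed.

Lemma circle_avg_norm K M f : tame K M f -> `|circle_avg f| <= M.
Proof.
move=> tf; case: (tf) => fK fp fM.
have M0 : 0 <= M by exact: le_trans (normr_ge0 _) (fM 0).
have K0 : 0 <= K.
  have := fK 1 0; rewrite subr0 normr1 mulr1; exact: le_trans (normr_ge0 _).
have t0 : tame K M (cst 0).
  by split=> [x y|x|x]; rewrite /= ?subrr ?normr0// mulr_ge0.
have := circle_avg_lipschitz tf t0; rewrite {2}/circle_avg /= Rintegral_cst// mul0r mulr0 subr0.
by apply => x /=; rewrite subr0.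
Qed.
End Riemann.

Section Riemann3.
Variable R : realType.
Implicit Types (K M : R).

Definition circle_sum L (f : R -> R) : R := L%:R^-1 * \sum_(j < L) f (freq R j).

Lemma circle_sum_le L (f g : R -> R) e : (0 < L)%N ->
  (forall x, `|f x - g x| <= e) -> `|circle_sum L f - circle_sum L g| <= e.
Proof.
move=> L0 fg; rewrite /circle_sum -mulrBr -sumrB normrM normfV.
have l0 : 0 < L%:R :> R by rewrite ltr0n.
rewrite (gtr0_norm l0) ler_pdivrMl//; apply: le_trans (ler_norm_sum _ _ _) _.
have -> : L%:R * e = \sum_(j < L) e by rewrite sumr_const card_ord mulr_natl.
exact: ler_sum.
Qed.

Lemma tame_circle_avg K M (g : R -> R -> R) :
  (forall x, tame K M (g x)) -> (forall y, tame K M (g^~ y)) ->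
  tame K M (fun x => circle_avg (g x)).
Proof.
move=> t1 t2; split.
- by move=> x y; apply: (circle_avg_lipschitz (t1 x) (t1 y)) => z; case: (t2 z).
- by move=> x; congr circle_avg; apply/funext => y; case: (t2 y).
- by move=> x; apply: (circle_avg_norm (t1 x)).
Qed.

Lemma circle_avgZ K M (f : R -> R) a : tame K M f ->
  circle_avg (fun x => a * f x) = a * circle_avg f.
Proof.
move=> tf; rewrite /circle_avg mulrCA RintegralZl//.
exact: tame_integrable tf.
Qed.

(** Sums are replaced by integrals one variable at a time, starting with the innermost;
    [tame_circle_avg] keeps the constants fixed. *)
Lemma riemann3 K M L (g : R -> R -> R -> R) : (0 < L)%N ->
  (forall x y, tame K M (g x y)) -> (forall x z, tame K M (fun y => g x y z)) ->
  (forall y z, tame K M (fun x => g x y z)) ->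
  `|circle_sum L (fun x => circle_sum L (fun y => circle_sum L (g x y))) -
    circle_avg (fun x => circle_avg (fun y => circle_avg (g x y)))|
  <= 3 * (2 * pi * K / L%:R).
Proof.
move=> L0 tz ty tx; set e := 2 * pi * K / L%:R.
pose h x y := circle_avg (g x y).
have hy x : tame K M (h x) by apply: tame_circle_avg.
have hx y : tame K M (h^~ y) by apply: tame_circle_avg.
pose k x := circle_avg (h x).
have tk : tame K M k by exact: tame_circle_avg.
have s1 : `|circle_sum L (fun x => circle_sum L (fun y => circle_sum L (g x y))) -
    circle_sum L (fun x => circle_sum L (h x))| <= e.
  apply: circle_sum_le => // x; apply: circle_sum_le => // y.
  exact: circle_avg_riemann (tz x y) L0.
have s2 : `|circle_sum L (fun x => circle_sum L (h x)) - circle_sum L k| <= e.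
  by apply: circle_sum_le => // x; exact: circle_avg_riemann (hy x) L0.
have s3 : `|circle_sum L k - circle_avg k| <= e by exact: circle_avg_riemann tk L0.
move: s1 s2 s3; rewrite -/k; set a := circle_sum _ _; set b := circle_sum _ _.
set c := circle_sum _ _; set d := circle_avg _ => s1 s2 s3.
have -> : a - d = (a - b) + (b - c) + (c - d) by ring.
apply: le_trans (ler_normD _ _) _; have := ler_normD (a - b) (b - c); lra.
Qed.
End Riemann3.

(** * Iterated integrals over the momentum cube *)

Section Fubini.
Variables (R : realType) (d1 d2 : measure_display).
Variables (T1 : measurableType d1) (T2 : measurableType d2).
Variables (m1 : {sigma_finite_measure set T1 -> \bar R}).
Variables (m2 : {sigma_finite_measure set T2 -> \bar R}).
Variables (A : set T1) (B : set T2) (g : T1 * T2 -> R) (M : R).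
Hypotheses (mA : measurable A) (mB : measurable B).
Hypotheses (fA : (m1 A < +oo)%E) (fB : (m2 B < +oo)%E).
Hypotheses (mg : measurable_fun (A `*` B) g).
Hypothesis (gM : forall z, (A `*` B) z -> `|g z| <= M).

Let mAB : measurable (A `*` B). Proof. exact: measurableX. Qed.

Lemma product_measure_lty : ((m1 \x m2)%E (A `*` B) < +oo)%E.
Proof. by rewrite product_measure1E// lte_mul_pinfty// ge0_fin_numE. Qed.

Let mgx x : A x -> measurable_fun B (fun y => g (x, y)).
Proof.
move=> Ax; apply: (@measurable_comp _ _ _ _ _ _ (A `*` B) g B (pair x)) => //.
  by move=> _ [y By <-].
exact: measurable_funTS.
Qed.

(** Extension by zero reduces Fubini on a rectangle to Fubini on the whole product. *)
Let G (z : T1 * T2) : \bar R := ((EFin \o g) \_ (A `*` B)) z.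

Let iG : (m1 \x m2)%E.-integrable setT G.
Proof.
apply/(integrable_mkcond _ mAB); apply: (integrable_bounded _ _ mg gM) => //.
exact: product_measure_lty.
Qed.

Let innerE x : A x ->
  (\int[m2]_y G (x, y))%E = (\int[m2]_(y in B) g (x, y))%:E.
Proof.
move=> Ax; rewrite /Rintegral fineK; last first.
  apply: integrable_fin_num => //.
  apply: (@integrable_bounded _ _ _ _ _ _ M) => //; first exact: mgx.
  by move=> y By; exact: gM.
rewrite [RHS]integral_mkcond; apply: eq_integral => y _.
rewrite /G /patch; have [By|By] := boolP (y \in B).
- by rewrite mem_set//; split => //=; exact/set_mem.
- by rewrite memNset// => -[_ /= /mem_set]; rewrite (negbTE By).
Qed.

Let inner0 x : ~ A x -> (\int[m2]_y G (x, y) = 0)%E.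
Proof.
by move=> Ax; apply: integral0_eq => y _; rewrite /G /patch memNset// => -[].
Qed.

Lemma Rfubini : \int[(m1 \x m2)%E]_(z in A `*` B) g z =
  \int[m1]_(x in A) \int[m2]_(y in B) g (x, y).
Proof.
rewrite /Rintegral; congr fine.
rewrite integral_mkcond -/G -(integral12_prod_meas1 iG) [RHS]integral_mkcond.
apply: eq_integral => x _; rewrite /fubini_F /patch.
have [Ax|Ax] := boolP (x \in A); first by rewrite innerE//; exact/set_mem.
by rewrite inner0// => /mem_set; rewrite (negbTE Ax).
Qed.

(** Needed to apply [Rfubini] a second time, to the inner integral. *)
Lemma measurable_inner_Rintegral :
  measurable_fun A (fun x => \int[m2]_(y in B) g (x, y)).
Proof.
have mF : measurable_fun A (fun x => \int[m2]_y G (x, y))%E.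
  by apply: measurable_funTS; exact: (measurable_fubini_F iG).
apply/measurable_EFinP; apply: eq_measurable_fun mF => x /set_mem Ax.
by rewrite innerE.
Qed.
End Fubini.

Section ProductSigmaFinite.
Variables (R : realType) (d1 d2 : measure_display).
Variables (T1 : measurableType d1) (T2 : measurableType d2).
Variables (m1 : {sigma_finite_measure set T1 -> \bar R}).
Variables (m2 : {sigma_finite_measure set T2 -> \bar R}).

(** Both exhaustions are taken increasing, so that a point of [F i] times [G j] already lies in the
    diagonal product of index [maxn i j]. *)
Lemma sigma_finite_product : sigma_finite setT (m1 \x m2)%E.
Proof.
have /sigma_finiteP[F [TF ndF Ffin]] := sigma_finiteT m1.
have /sigma_finiteP[G [TG ndG Gfin]] := sigma_finiteT m2.
exists (fun n => F n `*` G n) => [|n]; last first.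
  have [mF fF] := Ffin n; have [mG fG] := Gfin n.
  by split; [exact: measurableX|exact: product_measure_lty].
apply/seteqP; split => // -[x y] _.
have [i _ Fx] : (\bigcup_i F i) x by rewrite -TF.
have [j _ Gy] : (\bigcup_i G i) y by rewrite -TG.
exists (maxn i j) => //; split => /=.
- by move: x Fx; apply/subsetPset/ndF/leq_maxl.
- by move: y Gy; apply/subsetPset/ndG/leq_maxr.
Qed.

(* The library's canonical sigma-finite structure on [m1 \x m2] is only found
   when both factors are subprobabilities. *)
Definition product_sf : {sigma_finite_measure set (T1 * T2)%type -> \bar R} :=
  HB.pack_for {sigma_finite_measure set (T1 * T2)%type -> \bar R}
    (m1 \x m2)%E
    (Measure_isSigmaFinite.Build _ _ _ (m1 \x m2)%E sigma_finite_product).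
End ProductSigmaFinite.

Section Cube.
Variable R : realType.
Notation mu := (@lebesgue_measure R).
Let I : set R := `[- pi, pi]%classic.
Let mI : measurable I. Proof. exact: measurable_itv. Qed.
Let fI : (mu I < +oo)%E. Proof. exact: lebesgue_measure_itv_fin. Qed.

Lemma Rintegral_cube K M (g : R -> R -> R -> R) :
  measurable_fun setT (fun k : R * R * R => g k.1.1 k.1.2 k.2) ->
  (forall x y, tame K M (g x y)) -> (forall x z, tame K M (fun y => g x y z)) ->
  (forall y z, tame K M (fun x => g x y z)) ->
  ((2 * pi) ^+ 3)^-1 * \int[((mu \x mu) \x mu)%E]_(k in I `*` I `*` I) g k.1.1 k.1.2 k.2 =
  circle_avg (fun x => circle_avg (fun y => circle_avg (g x y))).
Proof.
move=> mg tz ty tx.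
have gM k : `|g k.1.1 k.1.2 k.2| <= M by case: (tz k.1.1 k.1.2).
have mII : measurable (I `*` I) by exact: measurableX.
have fII : ((mu \x mu)%E (I `*` I) < +oo)%E by exact: product_measure_lty.
have p0 : 0 < 2 * pi :> R by exact: twopi_gt0.
have avgE (f : R -> R) : \int[mu]_(x in I) f x = 2 * pi * circle_avg f.
  by rewrite /circle_avg mulVKf ?gt_eqF.
pose G (k : R * R * R) := g k.1.1 k.1.2 k.2.
have mG : measurable_fun (I `*` I `*` I) G by exact: measurable_funTS.
have -> : \int[((mu \x mu) \x mu)%E]_(k in I `*` I `*` I) g k.1.1 k.1.2 k.2 =
    \int[(mu \x mu)%E]_(z in I `*` I) \int[mu]_(y in I) G (z, y).
  exact: (@Rfubini R _ _ _ _ (product_sf mu mu) mu (I `*` I) I G M mII mI fII fI mG (fun k _ => gM k)).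
have mh := @measurable_inner_Rintegral R _ _ _ _ (product_sf mu mu) mu (I `*` I) I G M
  mII mI fII fI mG (fun k _ => gM k).
pose H (z : R * R) := \int[mu]_(y in I) G (z, y).
have HM z : (I `*` I) z -> `|H z| <= 2 * pi * M.
  move=> _; rewrite /H avgE normrM (gtr0_norm p0) ler_wpM2l ?(ltW p0)//.
  exact: circle_avg_norm (tz _ _).
have -> : \int[(mu \x mu)%E]_(z in I `*` I) \int[mu]_(y in I) G (z, y) =
    \int[mu]_(x in I) \int[mu]_(y in I) H (x, y).
  exact: (@Rfubini R _ _ _ _ mu mu I I H (2 * pi * M) mI mI fI fI mh HM).
have t2 x : tame K M (fun y => circle_avg (g x y)) by exact: tame_circle_avg.
have t3 : tame K M (fun x => circle_avg (fun y => circle_avg (g x y))).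
  by apply: tame_circle_avg => // y; exact: tame_circle_avg.
have e1 x : \int[mu]_(y in I) H (x, y) =
    (2 * pi) ^+ 2 * circle_avg (fun y => circle_avg (g x y)).
  under eq_Rintegral do rewrite /H avgE.
  by rewrite avgE (circle_avgZ _ (t2 x)) mulrA -expr2.
under eq_Rintegral do rewrite e1.
rewrite avgE (circle_avgZ _ t3) mulrA -exprS mulKf//.
by rewrite expf_neq0// gt_eqF.
Qed.
End Cube.

(** * Regularity of the massive spin-wave integrand *)

Section Massive.
Variable R : realType.
Notation mu := (@lebesgue_measure R).
Implicit Types (c lam x y z : R).

Lemma ln_lipschitz lam (a b : R) : 0 < lam -> lam <= a -> lam <= b ->
  `|ln a - ln b| <= lam^-1 * `|a - b|.
Proof.
move=> l0; wlog ab : a b / b <= a => [H la lb|la lb].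
  by case/orP: (le_total b a) => h; [|rewrite distrC (distrC a)]; exact: H.
have b0 : 0 < b by lra.
have a0 : 0 < a by lra.
rewrite !ger0_norm ?subr_ge0 ?ler_ln// -ln_div ?posrE//.
have -> : a / b = 1 + (a - b) / b by field; rewrite gt_eqF.
have h : 0 <= (a - b) / b by rewrite divr_ge0 ?(ltW b0)// subr_ge0.
apply: le_trans (le_ln1Dx _) _; first by lra.
by rewrite mulrC ler_wpM2r ?subr_ge0// lef_pV2.
Qed.

Lemma cos_lipschitz x y : `|cos x - cos y| <= `|x - y|.
Proof.
rewrite -!sinDpihalf; apply: le_trans (sin_lipschitz _ _) _.
by rewrite opprD addrACA subrr addr0.
Qed.

Lemma weight_ge0 c : [/\ 0 <= weight1 c, 0 <= weight2 c & 0 <= weight3 c].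
Proof. by split; exact: sqr_ge0. Qed.

Lemma dispersion_le6 c x y z :
  dispersion (weight1 c) (weight2 c) (weight3 c) x y z <= 6.
Proof.
have [w1 w2 w3] := weight_ge0 c; have ws := weight_sum c; rewrite /dispersion.
have h (q t : R) : 0 <= q -> q * (2 - 2 * cos t) <= q * 4.
  by move=> q0; rewrite ler_wpM2l//; have := cos_geN1 t; lra.
by have := h _ x w1; have := h _ y w2; have := h _ z w3; lra.
Qed.

(** The logarithm contributes [1 / lam], and each summand of the dispersion is Lipschitz with
    constant [2 * (3 / 2)], as no weight exceeds [3 / 2]. *)
Lemma massive_lipschitz c lam x y z x' y' z' : 0 < lam ->
  `|massive c lam x y z - massive c lam x' y' z'| <=
  3 / lam * (`|x - x'| + `|y - y'| + `|z - z'|).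
Proof.
move=> l0; have [w1 w2 w3] := weight_ge0 c; have ws := weight_sum c.
apply: le_trans (ln_lipschitz l0 _ _) _; rewrite ?lerDl ?dispersion_ge0//.
rewrite (mulrC 3) -mulrA ler_wpM2l ?invr_ge0 ?(ltW l0)//.
rewrite /dispersion.
have h (q t t' : R) : 0 <= q -> q <= 3 / 2 ->
    `|q * (2 - 2 * cos t) - q * (2 - 2 * cos t')| <= 3 * `|t - t'|.
  move=> q0 q1; have -> : q * (2 - 2 * cos t) - q * (2 - 2 * cos t') = 2 * q * (cos t' - cos t) by ring.
  rewrite normrM ger0_norm; last lra.
  by rewrite (distrC t); apply: ler_pM => //; [lra|lra|exact: cos_lipschitz].
have h1 := h (weight1 c) x x' w1; have h2 := h (weight2 c) y y' w2.
have h3 := h (weight3 c) z z' w3.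
have {}h1 := h1 ltac:(lra); have {}h2 := h2 ltac:(lra); have {}h3 := h3 ltac:(lra).
set a1 := weight1 c * _ in h1 *; set b1 := weight1 c * _ in h1 *.
set a2 := weight2 c * _ in h2 *; set b2 := weight2 c * _ in h2 *.
set a3 := weight3 c * _ in h3 *; set b3 := weight3 c * _ in h3 *.
have -> : lam + (a1 + a2 + a3) - (lam + (b1 + b2 + b3)) = (a1 - b1) + (a2 - b2) + (a3 - b3) by ring.
apply: le_trans (ler_normD _ _) _; have := ler_normD (a1 - b1) (a2 - b2); lra.
Qed.

Lemma massive_norm c lam x y z : 0 < lam ->
  `|massive c lam x y z| <= `|ln lam| + `|ln (lam + 6)|.
Proof.
move=> l0; rewrite /massive.
have e0 := dispersion_ge0 c x y z; have e6 := dispersion_le6 c x y z.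
set E := dispersion _ _ _ _ _ _ in e0 e6 *.
have h1 : ln lam <= ln (lam + E) by rewrite ler_ln ?posrE; lra.
have h2 : ln (lam + E) <= ln (lam + 6) by rewrite ler_ln ?posrE; lra.
rewrite ler_norml; apply/andP; split.
- by have := ler_norm (- ln lam); rewrite normrN; have := normr_ge0 (ln (lam + 6)); lra.
- by have := ler_norm (ln (lam + 6)); have := normr_ge0 (ln lam); lra.
Qed.

Lemma cosD_2pi x : cos (x + 2 * pi) = cos x.
Proof. by rewrite mulr_natl cosD2pi. Qed.

Lemma massive_tame c lam : 0 < lam ->
  let K := 3 / lam in let M := `|ln lam| + `|ln (lam + 6)| in
  [/\ forall x y, tame K M (massive c lam x y),
      forall x z, tame K M (fun y => massive c lam x y z) &
      forall y z, tame K M (fun x => massive c lam x y z)].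
Proof.
move=> l0 K M; split=> u v; split.
- move=> s t; apply: le_trans (massive_lipschitz _ _ _ _ _ _ _ l0) _.
  by rewrite !subrr normr0 !add0r.
- by move=> s; rewrite /massive /dispersion cosD_2pi.
- by move=> s; exact: massive_norm.
- move=> s t; apply: le_trans (massive_lipschitz _ _ _ _ _ _ _ l0) _.
  by rewrite !subrr normr0 add0r addr0.
- by move=> s; rewrite /massive /dispersion cosD_2pi.
- by move=> s; exact: massive_norm.
- move=> s t; apply: le_trans (massive_lipschitz _ _ _ _ _ _ _ l0) _.
  by rewrite !subrr normr0 !addr0.
- by move=> s; rewrite /massive /dispersion cosD_2pi.
- by move=> s; exact: massive_norm.
Qed.

Definition circle : set R := `[- pi, pi]%classic.
Definition cube : set (R * R * R) := circle `*` circle `*` circle.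

Definition cube_avg c lam : R := ((2 * pi) ^+ 3)^-1 *
  \int[((mu \x mu) \x mu)%E]_(k in cube) massive c lam k.1.1 k.1.2 k.2.

Lemma measurable_dispersion c : measurable_fun setT
  (fun k : R * R * R => dispersion (weight1 c) (weight2 c) (weight3 c) k.1.1 k.1.2 k.2).
Proof.
have mc : measurable_fun setT (@cos R).
  by apply: continuous_measurable_fun; exact: continuous_cos.
have h (q : R) (p : R * R * R -> R) : measurable_fun setT p ->
    measurable_fun setT (fun k => q * (2 - 2 * cos (p k))).
  move=> mp; apply: measurable_funM => //; apply: measurable_funB => //.
  by apply: measurable_funM => //; exact: measurableT_comp.
apply: measurable_funD; [apply: measurable_funD|]; apply: h.
- exact: (measurableT_comp measurable_fst measurable_fst).
- exact: (measurableT_comp measurable_snd measurable_fst).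
- exact: measurable_snd.
Qed.

Lemma measurable_massive c lam : measurable_fun setT
  (fun k : R * R * R => massive c lam k.1.1 k.1.2 k.2).
Proof.
apply: measurableT_comp; first exact: measurable_ln.
by apply: measurable_funD => //; exact: measurable_dispersion.
Qed.

(** The error blows up as the mass vanishes, so the mass has to be fixed before [L] tends to
    infinity. *)
Lemma lattice_avg_cube L c lam : (0 < L)%N -> 0 < lam ->
  `|lattice_avg L c lam - cube_avg c lam| <= 3 * (2 * pi * (3 / lam) / L%:R).
Proof.
move=> L0 l0; have [tz ty tx] := massive_tame c l0.
rewrite /cube_avg (Rintegral_cube (measurable_massive c lam) tz ty tx).
suff -> : lattice_avg L c lam = circle_sum L (fun x => circle_sum L (fun y =>
    circle_sum L (massive c lam x y))) by exact: riemann3.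
rewrite /lattice_avg /circle_sum natrX -exprVn.
transitivity (L%:R^-1 * (L%:R^-1 * (L%:R^-1 * \sum_(i < L) \sum_(j < L) \sum_(l < L)
    massive c lam (freq R i) (freq R j) (freq R l)))).
  rewrite pair_bigA /= pair_bigA /= !mulrA -expr2 -exprSr; congr (_ * _).
congr (_ * _); rewrite [LHS]mulrA [LHS]mulr_sumr; apply: eq_bigr => i _.
by rewrite -mulrA; congr (_ * _); rewrite mulr_sumr.
Qed.
End Massive.

(** * Removing the mass *)

Section Tonelli.
Variables (R : realType) (d1 d2 : measure_display).
Variables (T1 : measurableType d1) (T2 : measurableType d2).
Variables (m1 : {sigma_finite_measure set T1 -> \bar R}).
Variables (m2 : {sigma_finite_measure set T2 -> \bar R}).
Variables (A : set T1) (B : set T2).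
Hypotheses (mA : measurable A) (mB : measurable B).

(** With its companion [tonelli_snd], this reduces the integral of a singular majorant in a single
    momentum coordinate to dimension one. *)
Lemma tonelli_fst (f : T1 -> \bar R) : measurable_fun setT f -> (forall x, (0 <= f x)%E) ->
  (\int[m1 \x m2]_(z in A `*` B) f z.1 = m2 B * \int[m1]_(x in A) f x)%E.
Proof.
move=> mf f0; have mAB : measurable (A `*` B) by exact: measurableX.
have mfz : measurable_fun setT (fun z : T1 * T2 => f z.1).
  by apply: measurableT_comp => //; exact: measurable_fst.
rewrite integral_mkcond fubini_tonelli1; last 2 first.
- have := (measurable_restrictT (D := A `*` B) _ mAB).1 (measurable_funTS mfz); exact.
- by move=> z; apply: erestrict_ge0 => ? _; exact: f0.
rewrite -ge0_integralZl//=; last exact: measurable_funTS.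
rewrite [RHS]integral_mkcond; apply: eq_integral => x _; rewrite /fubini_F.
rewrite {2}/patch; case: ifPn => Ax.
- rewrite muleC -integral_cst// [RHS]integral_mkcond; apply: eq_integral => y _.
  by rewrite /patch in_setX/= Ax.
- by apply: integral0_eq => y _; rewrite /patch in_setX/= (negbTE Ax).
Qed.

Lemma tonelli_snd (f : T2 -> \bar R) : measurable_fun setT f -> (forall x, (0 <= f x)%E) ->
  (\int[m1 \x m2]_(z in A `*` B) f z.2 = m1 A * \int[m2]_(y in B) f y)%E.
Proof.
move=> mf f0; have mAB : measurable (A `*` B) by exact: measurableX.
have mfz : measurable_fun setT (fun z : T1 * T2 => f z.2).
  by apply: measurableT_comp => //; exact: measurable_snd.
rewrite integral_mkcond fubini_tonelli2; last 2 first.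
- have := (measurable_restrictT (D := A `*` B) _ mAB).1 (measurable_funTS mfz); exact.
- by move=> z; apply: erestrict_ge0 => ? _; exact: f0.
rewrite -ge0_integralZl//=; last exact: measurable_funTS.
rewrite [RHS]integral_mkcond; apply: eq_integral => y _; rewrite /fubini_G.
rewrite {2}/patch; case: ifPn => By.
- rewrite muleC -integral_cst// [RHS]integral_mkcond; apply: eq_integral => x _.
  by rewrite /patch in_setX/= By andbT.
- by apply: integral0_eq => x _; rewrite /patch in_setX/= (negbTE By) andbF.
Qed.
End Tonelli.

(** * Integrability of [|t|^(-1/2)] at the origin *)

Section InverseSqrt.
Variable R : realType.
Notation mu := (@lebesgue_measure R).

Lemma measurable_inv_sqrt : measurable_fun setT (fun t : R => (Num.sqrt `|t|)^-1).
Proof.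
(* The inverse of 0 is 0, so the value at the origin has to be split off. *)
have E : (fun t : R => (Num.sqrt `|t|)^-1) = (fun t => if t == 0 then 0 else expR (- (ln `|t| / 2))).
  apply/funext => t; case: eqVneq => [->|t0]; first by rewrite normr0 sqrtr0 invr0.
  by rewrite sqrt_expR_ln ?normr_gt0// expRN.
rewrite E; apply: measurable_fun_ifT => //.
- by apply: measurable_fun_eqr.
- apply: measurableT_comp => //; apply: measurableT_comp => //; apply: measurable_funM => //.
  by apply: measurableT_comp; [exact: measurable_ln|exact: normr_measurable].
Qed.

(** Away from 0 the primitive [2 sqrt t] applies; its value at [e] is dropped, which makes the bound
    uniform in [e]. *)
Lemma integral_inv_sqrt_ge (e b : R) : 0 < e -> e < b ->
  (\int[mu]_(t in `[e, b]) ((Num.sqrt `|t|)^-1)%:E <= (2 * Num.sqrt b)%:E)%E.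
Proof.
move=> e0 eb; pose F (t : R) : R := 2 * Num.sqrt t.
have dF (t : R) : 0 < t -> is_derive t 1 F (Num.sqrt t)^-1.
  move=> t0; have h := is_derive1_sqrt t0.
  apply: is_derive_eq.
  by rewrite /GRing.scale /= invfM mulrA divff ?mul1r.
have -> : (\int[mu]_(t in `[e, b]) ((Num.sqrt `|t|)^-1)%:E =
    \int[mu]_(t in `[e, b]) ((Num.sqrt t)^-1)%:E)%E.
  apply: eq_integral => t; rewrite inE/= in_itv/= => /andP[et _]; rewrite ger0_norm//; lra.
rewrite (@continuous_FTC2 _ _ F)//.
- rewrite -EFinB lee_fin /F; have := sqrtr_ge0 e; lra.
- apply: continuous_in_subspaceT => t; rewrite inE/= in_itv/= => /andP[et _].
  apply: cvgV; first by rewrite gt_eqF// sqrtr_gt0; lra.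
  exact: sqrt_continuous.
- split.
  + by move=> t; rewrite in_itv/= => /andP[et _]; have [] := dF t ltac:(lra).
  + apply: cvg_at_right_filter; apply: cvgM; [exact: cvg_cst|exact: sqrt_continuous].
  + apply: cvg_at_left_filter; apply: cvgM; [exact: cvg_cst|exact: sqrt_continuous].
- move=> t; rewrite in_itv/= => /andP[et _]; rewrite derive1E.
  by have h := dF t ltac:(lra); rewrite derive_val.
Qed.

(** Monotone convergence along the intervals [[1 / (n + 1), b]]. *)
Lemma integral_inv_sqrt (b : R) : 0 < b ->
  (\int[mu]_(t in `]0%R, b]) ((Num.sqrt `|t|)^-1)%:E <= (2 * Num.sqrt b)%:E)%E.
Proof.
move=> b0; pose F (n : nat) : set R := `[n.+1%:R^-1, b]%classic.
have mf : measurable_fun setT (fun t : R => ((Num.sqrt `|t|)^-1)%:E).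
  by apply/measurable_EFinP; exact: measurable_inv_sqrt.
have FE : \bigcup_n F n = `]0%R, b]%classic.
  apply/seteqP; split => t /=.
  - move=> [n _]; rewrite /F/= !in_itv/= => /andP[nt ->]; rewrite andbT.
    by apply: lt_le_trans nt; rewrite invr_gt0 ltr0n.
  - rewrite in_itv/= => /andP[t0 tb]; exists (Num.truncn t^-1) => //.
    rewrite /F/= in_itv/= tb andbT invf_ple ?posrE ?ltr0n//.
    by rewrite ltW// truncnS_gt.
rewrite -FE.
have cvgF : (\int[mu]_(t in F n) ((Num.sqrt `|t|)^-1)%:E)%E @[n --> \oo] -->
    (\int[mu]_(t in \bigcup_n F n) ((Num.sqrt `|t|)^-1)%:E)%E.
  apply: ge0_nondecreasing_set_cvg_integral.
  - apply/nondecreasing_seqP => n; rewrite subsetEset => t; rewrite /F/= !in_itv/= => /andP[h ->].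
    by rewrite andbT; apply: le_trans h; rewrite lef_pV2 ?posrE ?ltr0n// ler_nat.
  - by move=> n; exact: measurable_itv.
  - by move=> n; exact: measurable_funTS.
  - by move=> n t _; rewrite lee_fin invr_ge0 sqrtr_ge0.
rewrite -(cvg_lim _ cvgF)//; apply: lime_le; first by apply/cvg_ex; eexists; exact: cvgF.
near=> n; have [nb|nb] := ltP n.+1%:R^-1 b.
  by apply: integral_inv_sqrt_ge => //; rewrite invr_gt0 ltr0n.
move: nb; rewrite le_eqVlt => /predU1P[bE|bn].
- by rewrite /F -bE set_itv1 integral_set1 lee_fin mulr_ge0 ?sqrtr_ge0.
- by rewrite /F set_itv_ge ?bnd_simp -?ltNge// integral_set0 lee_fin mulr_ge0 ?sqrtr_ge0.
Unshelve. all: by end_near. Qed.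

Lemma integral_inv_sqrt_sym (b : R) : 0 < b ->
  (\int[mu]_(t in `[(- b)%R, b] `\ 0%R) ((Num.sqrt `|t|)^-1)%:E <= (4 * Num.sqrt b)%:E)%E.
Proof.
move=> b0.
have mf : measurable_fun setT (fun t : R => ((Num.sqrt `|t|)^-1)%:E).
  by apply/measurable_EFinP; exact: measurable_inv_sqrt.
have -> : `[(- b)%R, b]%classic `\ 0%R = `[(- b)%R, 0%R[%classic `|` `]0%R, b]%classic.
  apply/seteqP; split => t /=; rewrite !in_itv/=.
  - move=> [/andP[h1 h2] /eqP]; rewrite neq_lt => /orP[t0|t0]; [left|right]; apply/andP; split => //.
  - move=> [|] /andP[h1 h2]; (split; first by apply/andP; split; lra).
    + by apply/eqP; rewrite lt_eqF.
    + by apply/eqP; rewrite gt_eqF.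
rewrite ge0_integral_setU; [|exact: measurable_itv|exact: measurable_itv| | |]; last 3 first.
- exact: measurable_funS mf.
- by move=> t _; rewrite lee_fin invr_ge0 sqrtr_ge0.
- apply/disj_setPS => t [] /=; rewrite !in_itv/= => /andP[_ h1] /andP[h2 _].
  by have := lt_trans h1 h2; rewrite ltxx.
have -> : (\int[mu]_(t in `[(- b)%R, 0%R[) ((Num.sqrt `|t|)^-1)%:E =
   \int[mu]_(t in `]0%R, b]) ((Num.sqrt `|t|)^-1)%:E)%E.
  have -> : `[(- b)%R, 0%R[%classic = (-%R : _ -> measurableTypeR R) @^-1` `]0%R, b].
    by rewrite opp_preimage_itvbndbnd oppr0.
  transitivity (\int[mu]_(t in (-%R : _ -> measurableTypeR R) @^-1` `]0%R, b])
     ((fun t : R => ((Num.sqrt `|t|)^-1)%:E) \o -%R) t)%E.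
    by apply: eq_integral => t _ /=; rewrite normrN.
  rewrite -ge0_integral_pushforward//=.
  - by apply: eq_measure_integral => //= A mA AS; exact: lebesgue_measureN.
  exact: measurable_funTS.
have h := integral_inv_sqrt b0.
rewrite (_ : 4 * Num.sqrt b = 2 * Num.sqrt b + 2 * Num.sqrt b); last by ring.
by rewrite EFinD; exact: leeD.
Qed.
End InverseSqrt.

(** * The logarithm near the zero of the dispersion *)

Section LogBound.
Variable R : realType.
Notation mu := (@lebesgue_measure R).
Implicit Types (c lam t : R).

(** Up to 1 the mean value theorem gives slope at least [cos 1]. Beyond 1 the sine is at least
    [sin 1 >= cos 1], while [t / 2 <= 1]. *)
Lemma sin_ge_linear t : 0 <= t -> t <= pi / 2 -> cos 1 / 2 * t <= sin t.
Proof.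
move=> t0 tpi; have c1 := @cos1_gt0 R; have p2 := @pihalf_lt2 R; have p1 := @pihalf_ge1 R.
have small (s : R) : 0 <= s -> s <= 1 -> cos 1 * s <= sin s.
  move=> s0 s1; have [|z] := @MVT_segment R sin cos 0 s s0.
    by apply: continuous_subspaceT; exact: continuous_sin.
  rewrite in_itv/= sin0 !subr0 => /andP[z0 zs] ->.
  rewrite ler_wpM2r// leNgt ltr_cos ?in_itv/= -?leNgt; try (apply/andP; split); lra.
have [t1|t1] := leP t 1.
  apply: le_trans (small _ t0 t1); rewrite ler_wpM2r//; lra.
apply: (@le_trans _ _ (sin 1)).
  apply: le_trans (small 1 _ _); [|lra|lra].
  by rewrite -mulrA ler_wpM2l ?(ltW c1)//; lra.
by rewrite leNgt ltr_sin ?in_itv/= -?leNgt; try (apply/andP; split); lra.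
Qed.

(** The constant produced by [1 - cos t = 2 sin(t / 2)^2] together with [sin_ge_linear] at
    [t / 2]. *)
Definition kap : R := cos 1 ^+ 2 / 8.

Lemma kap_gt0 : 0 < kap.
Proof. by rewrite divr_gt0// exprn_gt0// cos1_gt0. Qed.

Lemma one_sub_cos_ge t : `|t| <= pi -> kap * t ^+ 2 <= 1 - cos t.
Proof.
move=> tpi; rewrite -cos_norm -(real_normK (num_real t)); set s := `|t| in tpi *.
have s0 : 0 <= s by exact: normr_ge0.
have -> : 1 - cos s = 2 * sin (s / 2) ^+ 2.
  by rewrite {1}(splitr s) cosD -!expr2 cos2sin2; ring.
have h := @sin_ge_linear (s / 2) ltac:(lra) ltac:(lra).
have c1 := @cos1_gt0 R.
have : (cos 1 / 2 * (s / 2)) ^+ 2 <= sin (s / 2) ^+ 2.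
  rewrite lerXn2r ?nnegrE//; first by rewrite !mulr_ge0 ?(ltW c1)//; lra.
  by apply: le_trans h; rewrite !mulr_ge0 ?(ltW c1)//; lra.
have -> : (cos 1 / 2 * (s / 2)) ^+ 2 = kap * s ^+ 2 / 2 by rewrite /kap; field.
by lra.
Qed.

(* [ln (1 + y^4) <= 4 ln (1 + y) <= 4 y] with [y^4 = lam / (kap t^2)]. *)
Lemma ln_shift_le lam t (E : R) : 0 < lam -> t != 0 -> kap * t ^+ 2 <= E ->
  `|ln (lam + E) - ln E| <= 4 * Num.sqrt (Num.sqrt (lam / kap)) * (Num.sqrt `|t|)^-1.
Proof.
move=> l0 t0 tE; have k0 := kap_gt0.
have nt : 0 < `|t| by rewrite normr_gt0.
have kt : 0 < kap * t ^+ 2 by rewrite mulr_gt0// exprn_even_gt0.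
have E0 : 0 < E by lra.
pose y := Num.sqrt (Num.sqrt (lam / kap)) * (Num.sqrt `|t|)^-1.
have y0 : 0 <= y by rewrite mulr_ge0 ?invr_ge0 ?sqrtr_ge0.
have y4 : y ^+ 4 = lam / (kap * t ^+ 2).
  have y2 : y ^+ 2 = Num.sqrt (lam / kap) * `|t|^-1.
    by rewrite /y exprMn exprVn !sqr_sqrtr ?sqrtr_ge0.
  have -> : y ^+ 4 = (y ^+ 2) ^+ 2 by ring.
  have lk : 0 <= lam / kap by apply: divr_ge0; apply: ltW.
  rewrite y2 exprMn (sqr_sqrtr lk).
  by rewrite exprVn real_normK ?num_real//; field; rewrite t0 gt_eqF.
rewrite ger0_norm; last by rewrite subr_ge0 ler_ln ?posrE; lra.
rewrite -ln_div ?posrE//; last lra.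
apply: (@le_trans _ _ (ln (1 + y ^+ 4))).
  have e1 : (lam + E) / E = 1 + lam / E by field; rewrite gt_eqF.
  have h1 : lam / E <= lam / (kap * t ^+ 2) by rewrite ler_wpM2l ?(ltW l0)// lef_pV2.
  have h2 : 0 <= lam / E by rewrite divr_ge0// ltW.
  by rewrite e1 y4 ler_ln ?posrE; lra.
apply: (@le_trans _ _ (ln ((1 + y) ^+ 4))).
  rewrite ler_ln ?posrE; [|by rewrite ltr_pwDl// exprn_ge0|by rewrite exprn_gt0//; lra].
  have -> : (1 + y) ^+ 4 = 1 + y ^+ 4 + (4 * y + 6 * y ^+ 2 + 4 * y ^+ 3) by ring.
  by rewrite lerDl !addr_ge0 ?mulr_ge0 ?exprn_ge0.
rewrite lnXn; last lra.
rewrite -mulrA -/y -[leLHS]mulr_natl ler_wpM2l// le_ln1Dx//; lra.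
Qed.
End LogBound.

(** * Massive integral against spin-wave integral *)

Section SpinWave.
Variable R : realType.
Notation mu := (@lebesgue_measure R).
Notation mu3 := ((mu \x mu) \x mu)%E.
Implicit Types (c lam t : R).
Let C := @circle R.
Let mC : measurable C. Proof. exact: measurable_itv. Qed.
Let muC : mu C = (2 * pi)%:E.
Proof.
have pp := @pi_gt0 R.
by rewrite lebesgue_measure_itv/= lte_fin ifT -?EFinB; [congr (_%:E); ring|lra].
Qed.
Let mCC : measurable (C `*` C). Proof. exact: measurableX. Qed.
Let mcube : measurable (@cube R). Proof. exact: measurableX. Qed.
Let muCC : (mu \x mu)%E (C `*` C) = ((2 * pi) ^+ 2)%:E.
Proof. by rewrite product_measure1E// [X in (X * _)%E]muC [X in (_ * X)%E]muC. Qed.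

(** What the three coordinate maps of the cube have in common, so that one argument covers whichever
    weight is large. *)
Definition projects (p : R * R * R -> R) :=
  [/\ measurable_fun setT p, forall k, cube k -> C (p k) &
   forall f : R -> \bar R, measurable_fun setT f -> (forall x, (0 <= f x)%E) ->
   (\int[mu3]_(k in @cube R) f (p k) = ((2 * pi) ^+ 2)%:E * \int[mu]_(x in C) f x)%E].

Lemma projects11 : projects (fun k => k.1.1).
Proof.
split; first exact: (measurableT_comp measurable_fst measurable_fst).
  by move=> k [[]].
move=> f mf f0.
have m1 : measurable_fun setT (fun z : R * R => f z.1).
  by apply: measurableT_comp => //; exact: measurable_fst.
have e1 := @tonelli_fst R _ _ _ _ (product_sf mu mu) mu (C `*` C) C mCC mC
  (fun z => f z.1) m1 (fun z => f0 z.1).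
have e2 := @tonelli_fst R _ _ _ _ mu mu C C mC mC f mf f0.
rewrite [LHS]e1 [X in (_ * X)%E]e2 [X in (X * _)%E]muC [X in (_ * (X * _))%E]muC.
by rewrite muleA.
Qed.

Lemma projects12 : projects (fun k => k.1.2).
Proof.
split; first exact: (measurableT_comp measurable_snd measurable_fst).
  by move=> k [[]].
move=> f mf f0.
have m1 : measurable_fun setT (fun z : R * R => f z.2).
  by apply: measurableT_comp => //; exact: measurable_snd.
have e1 := @tonelli_fst R _ _ _ _ (product_sf mu mu) mu (C `*` C) C mCC mC
  (fun z => f z.2) m1 (fun z => f0 z.2).
have e2 := @tonelli_snd R _ _ _ _ mu mu C C mC mC f mf f0.
rewrite [LHS]e1 [X in (_ * X)%E]e2 [X in (X * _)%E]muC [X in (_ * (X * _))%E]muC.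
by rewrite muleA.
Qed.

Lemma projects2 : projects (fun k => k.2).
Proof.
split; first exact: measurable_snd.
  by move=> k [].
move=> f mf f0.
have e1 := @tonelli_snd R _ _ _ _ (product_sf mu mu) mu (C `*` C) C mCC mC f mf f0.
by rewrite [LHS]e1 [X in (X * _)%E]muCC.
Qed.

Definition sing_cst lam : R := 4 * Num.sqrt (Num.sqrt (lam / kap R)).

(** The value at 0 is set to [+oo]: there the inverse square root is 0 by convention and would not
    dominate. *)
Definition sing lam t : \bar R :=
  if t == 0 then +oo%E else (sing_cst lam * (Num.sqrt `|t|)^-1)%:E.

Lemma sing_cst_ge0 lam : 0 <= sing_cst lam.
Proof. by rewrite mulr_ge0 ?sqrtr_ge0. Qed.

Lemma sing_ge0 lam t : (0 <= sing lam t)%E.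
Proof.
rewrite /sing; case: ifP => // _.
by rewrite lee_fin mulr_ge0 ?sing_cst_ge0 ?invr_ge0 ?sqrtr_ge0.
Qed.

Lemma measurable_sing lam : measurable_fun setT (sing lam).
Proof.
apply: measurable_fun_ifT => //; first exact: measurable_fun_eqr.
by apply/measurable_EFinP; apply: measurable_funM => //; exact: measurable_inv_sqrt.
Qed.

Lemma integral_sing lam :
  (\int[mu]_(t in C) sing lam t <= (sing_cst lam * (4 * Num.sqrt pi))%:E)%E.
Proof.
rewrite -(@integral_setD1 _ (sing lam) 0); last 2 first.
- exact: measurableD.
- by apply: measurable_funTS; exact: measurable_sing.
have -> : (\int[mu]_(t in C `\ 0%R) sing lam t =
    \int[mu]_(t in C `\ 0%R) ((sing_cst lam)%:E * ((Num.sqrt `|t|)^-1)%:E))%E.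
  apply: eq_integral => t; rewrite inE => -[_ /eqP/negbTE t0].
  by rewrite /sing t0.
rewrite ge0_integralZl//=; last 3 first.
- exact: measurableD.
- apply: measurable_funTS; apply/measurable_EFinP; exact: measurable_inv_sqrt.
- by rewrite lee_fin sing_cst_ge0.
rewrite [leRHS]EFinM; apply: lee_wpmul2l; first by rewrite lee_fin sing_cst_ge0.
exact: integral_inv_sqrt_sym (pi_gt0 R).
Qed.

(** The dispersion is at least [kap * (p k)^2] on the cube, so [ln_shift_le] bounds the change of
    the logarithm by a function of the one coordinate [p k]. *)
Lemma sw_near_of_projection c lam (p : R * R * R -> R) : 0 < lam -> projects p ->
  (forall k, 1 - cos (p k) <=
     dispersion (weight1 c) (weight2 c) (weight3 c) k.1.1 k.1.2 k.2) ->
  `|\int[mu3]_(k in @cube R) massive c lam k.1.1 k.1.2 k.2 -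
    \int[mu3]_(k in @cube R) sw_integrand c k| <=
  (2 * pi) ^+ 2 * (sing_cst lam * (4 * Num.sqrt pi)).
Proof.
move=> l0 [mp pC pint] pE.
pose g (k : R * R * R) := massive c lam k.1.1 k.1.2 k.2.
pose f (k : R * R * R) := sw_integrand c k.
have mg : measurable_fun setT g by exact: measurable_massive.
have mf : measurable_fun setT f.
  have -> : f = @ln R \o (fun k => dispersion (weight1 c) (weight2 c) (weight3 c)
      k.1.1 k.1.2 k.2) by [].
  by apply: measurableT_comp; [exact: measurable_ln|exact: measurable_dispersion].
have fincube : (mu3 (@cube R) < +oo)%E.
  have := @product_measure_lty R _ _ _ _ (product_sf mu mu) mu (C `*` C) C mCC mC.
  by apply; [rewrite [X in (X < _)%E]muCC ltry|rewrite [X in (X < _)%E]muC ltry].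
have ig : mu3.-integrable (@cube R) (EFin \o g).
  apply: (@integrable_bounded _ _ _ _ _ _ (`|ln lam| + `|ln (lam + 6)|)) => //.
  - exact: measurable_funTS.
  - by move=> k _; exact: massive_norm.
have dom k : cube k -> (`|(g k - f k)%:E| <= sing lam (p k))%E.
  move=> /pC; rewrite /C /circle /= in_itv/= => ppi.
  rewrite /sing; case: eqVneq => [_|p0]; first by rewrite leey.
  rewrite lee_fin /=; apply: ln_shift_le => //.
  apply: le_trans (pE k); apply: one_sub_cos_ge; by rewrite ler_norml.
have msp : measurable_fun (@cube R) (fun k => sing lam (p k)).
  by apply: measurable_funTS; apply: measurableT_comp => //; exact: measurable_sing.
have isp_le : (\int[mu3]_(k in @cube R) sing lam (p k) <=
    ((2 * pi) ^+ 2 * (sing_cst lam * (4 * Num.sqrt pi)))%:E)%E.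
  rewrite pint; [|exact: measurable_sing|exact: sing_ge0].
  rewrite [leRHS]EFinM; apply: lee_wpmul2l; first by rewrite lee_fin sqr_ge0.
  exact: integral_sing.
have mgf : measurable_fun (@cube R) (fun k => (g k - f k)%:E).
  by apply/measurable_EFinP; apply: measurable_funB; exact: measurable_funTS.
have absle : (\int[mu3]_(k in @cube R) `|(g k - f k)%:E| <=
    ((2 * pi) ^+ 2 * (sing_cst lam * (4 * Num.sqrt pi)))%:E)%E.
  apply: le_trans isp_le; apply: le_ge0_integral => k Dk; [by []|exact: dom].
have igf : mu3.-integrable (@cube R) (EFin \o (fun k => g k - f k)).
  by apply/integrableP; split => //; apply: le_lt_trans absle _; rewrite ltry.
(* The spin-wave integrand is unbounded; it is integrable as the difference of the bounded massive
   integrand and the dominated [g - f]. *)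
have iif : mu3.-integrable (@cube R) (EFin \o f).
  have -> : EFin \o f = (fun k => (EFin \o g) k - (EFin \o (fun k => g k - f k)%R) k)%E.
    by apply/funext => k /=; rewrite -EFinB; congr (_%:E); ring.
  exact: integrableB.
have -> : \int[mu3]_(k in @cube R) massive c lam k.1.1 k.1.2 k.2 -
    \int[mu3]_(k in @cube R) sw_integrand c k = \int[mu3]_(k in @cube R) (g k - f k).
  by rewrite RintegralB.
rewrite -lee_fin; apply: le_trans absle.
rewrite EFin_normr_Rintegral//.
exact: le_abse_integral.
Qed.

(** The weights sum to [3 / 2], so one of them is at least [1 / 2], and the dispersion dominates
    [1 - cos] of that coordinate. The resulting bound is the same for all [c]. *)
Lemma cube_avg_F_sw c lam : 0 < lam ->
  `|cube_avg c lam / 2 - F_sw c| <= 2 * Num.sqrt pi / (2 * pi) * sing_cst lam.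
Proof.
move=> l0.
have key : `|\int[mu3]_(k in @cube R) massive c lam k.1.1 k.1.2 k.2 -
    \int[mu3]_(k in @cube R) sw_integrand c k| <=
    (2 * pi) ^+ 2 * (sing_cst lam * (4 * Num.sqrt pi)).
  have ws := weight_sum c; have [w1 w2 w3] := weight_ge0 c.
  have nn (q t : R) : 0 <= q -> 0 <= q * (2 - 2 * cos t).
    by move=> q0; rewrite mulr_ge0//; have := cos_le1 t; lra.
  have half (q t : R) : 1 / 2 <= q -> 1 - cos t <= q * (2 - 2 * cos t).
    move=> q2; have -> : 1 - cos t = 1 / 2 * (2 - 2 * cos t) by field.
    by rewrite ler_wpM2r//; have := cos_le1 t; lra.
  have [h1|h1] := leP (1 / 2) (weight1 c).
    apply: (sw_near_of_projection l0 projects11) => k; rewrite /dispersion.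
    by have := half _ k.1.1 h1; have := nn _ k.1.2 w2; have := nn _ k.2 w3; lra.
  have [h2|h2] := leP (1 / 2) (weight2 c).
    apply: (sw_near_of_projection l0 projects12) => k; rewrite /dispersion.
    by have := half _ k.1.2 h2; have := nn _ k.1.1 w1; have := nn _ k.2 w3; lra.
  have h3 : 1 / 2 <= weight3 c by lra.
  apply: (sw_near_of_projection l0 projects2) => k; rewrite /dispersion.
  by have := half _ k.2 h3; have := nn _ k.1.1 w1; have := nn _ k.1.2 w2; lra.
move: key; rewrite /cube_avg /F_sw.
set G := \int[mu3]_(k in _) massive _ _ _ _ _; set F := \int[mu3]_(k in _) sw_integrand _ _ => key.
have p0 := twopi_gt0 R; have sp := sqrtr_ge0 (pi : R).
move: key; move: (Num.sqrt pi : R) sp; move: (2 * pi : R) p0 => p p0 s s0 key.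
have -> : (p ^+ 3)^-1 * G / 2 - 1 / 2 * (p ^+ 3)^-1 * F = (p ^+ 3)^-1 / 2 * (G - F) by ring.
have p3 : 0 < (p ^+ 3)^-1 / 2 by rewrite divr_gt0// invr_gt0 exprn_gt0.
rewrite normrM (gtr0_norm p3).
apply: le_trans (ler_wpM2l (ltW p3) key) _.
by rewrite le_eqVlt; apply/orP; left; apply/eqP; field; rewrite gt_eqF.
Qed.
End SpinWave.

(** * Choice of the constants and passage to the limit *)

Section Assembly.
Variable R : realType.

Lemma limn_esup_le (u : nat -> \bar R) (l : \bar R) (n0 : nat) :
  (forall n, (n0 <= n)%N -> (u n <= l)%E) -> (limn_esup u <= l)%E.
Proof.
move=> ul; rewrite limn_esup_lim; apply: lime_le; first exact: is_cvg_esups.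
exists n0 => // n /= n0n; apply: ge_ereal_sup => _ [m /= nm <-].
exact: ul (leq_trans n0n nm).
Qed.

Lemma sing_cst_small (eta : R) : 0 < eta ->
  exists2 lam0, 0 < lam0 & forall lam, 0 < lam -> lam <= lam0 -> sing_cst lam <= eta.
Proof.
move=> e0; have k0 := kap_gt0 R.
have e4 : 0 < eta / 4 by rewrite divr_gt0.
(* The solution of [4 (lam / kap)^(1/4) = eta]. *)
exists (kap R * (eta / 4) ^+ 4); first by rewrite mulr_gt0// exprn_gt0.
move=> lam l0 ll; rewrite /sing_cst.
have h : lam / kap R <= ((eta / 4) ^+ 2) ^+ 2 by rewrite ler_pdivrMr// mulrC -exprM.
have h1 : Num.sqrt (lam / kap R) <= (eta / 4) ^+ 2.
  by apply: le_trans (ler_wsqrtr h) _; rewrite sqrtr_sqr ger0_norm// sqr_ge0.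
have h2 : Num.sqrt (Num.sqrt (lam / kap R)) <= eta / 4.
  by apply: le_trans (ler_wsqrtr h1) _; rewrite sqrtr_sqr ger0_norm// ltW.
by lra.
Qed.

Lemma lattice_avg_near c (lam eta : R) : 0 < lam -> 0 < eta ->
  exists n0 : nat, forall L, (n0 <= L)%N -> (0 < L)%N /\
    `|lattice_avg L c lam - cube_avg c lam| <= eta.
Proof.
move=> l0 e0; pose x := 3 * (2 * pi * (3 / lam)) / eta.
exists (Num.truncn x).+1 => L nL; have L0 : (0 < L)%N by exact: leq_trans nL.
split => //; apply: le_trans (lattice_avg_cube c L0 l0) _.
have xL : x <= L%:R.
  by apply: le_trans (ltW (truncnS_gt x)) _; rewrite ler_nat.
rewrite mulrA ler_pdivrMr ?ltr0n//; move: xL; rewrite /x ler_pdivrMr//.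
by rewrite (mulrC L%:R).
Qed.
End Assembly.

Theorem theorem4p1 (R : realType) (eps : R) (heps : 0 < eps) :
  exists2 delta : R, 0 < delta &
  forall J beta Delta : R, 0 < J -> 0 < beta -> 0 < Delta -> Delta < 1 ->
    (beta * J) * Delta ^+ 2 >= delta^-1 ->
    (beta * J) * Delta ^+ 3 <= delta ->
    forall thstar : R, 0 <= thstar -> thstar < 2 * pi ->
      (limn_esup (fun L : nat =>
         (`| F_Delta J beta Delta L thstar - F_sw thstar |)%:E) <= eps%:E)%E.
Proof.
have e8 : 0 < eps / 8 by rewrite divr_gt0.
pose C1 : R := 2 * Num.sqrt pi / (2 * pi).
have C1_gt0 : 0 < C1 by rewrite !divr_gt0 ?mulr_gt0 ?sqrtr_gt0 ?pi_gt0.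
(* The mass [lam0] depends on [eps] alone, so that the [delta] built from it does as well. *)
have [lam0 lam0_gt0 small] := @sing_cst_small R (eps / 8 / C1) (divr_gt0 e8 C1_gt0).
have near_sw c lam : 0 < lam -> lam <= lam0 -> `|cube_avg c lam / 2 - F_sw c| <= eps / 8.
  move=> l0 ll; apply: le_trans (cube_avg_F_sw c l0) _; rewrite -/C1.
  by rewrite mulrC -ler_pdivlMr//; exact: small.
pose a := lam0 ^+ 2 / (4 * (lam0 + 3)).
have a_gt0 : 0 < a by rewrite divr_gt0 ?exprn_gt0//; lra.
(* Chosen so that [- ln (1 - kp) = eps / 8]. *)
pose kp := 1 - expR (- (eps / 8)).
have kp_gt0 : 0 < kp by rewrite subr_gt0 expR_lt1; lra.
have kp_lt1 : kp < 1 by rewrite /kp; have := expR_gt0 (- (eps / 8)); lra.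
(* The first entry turns the error [12 b D^3] into at most [eps / 8]; the second makes the escape
   factor at most [kp / 2]. *)
pose delta := Num.min (eps / 96) (a * kp / 4).
have delta_gt0 : 0 < delta by rewrite lt_min !divr_gt0// mulr_gt0.
exists delta => // J beta D J0 beta0 D0 D1 hD2 hD3 c c0 c2.
set b := beta * J in hD2 hD3.
have b0 : 0 < b by exact: mulr_gt0.
have d96 : delta <= eps / 96 by rewrite ge_min lexx.
have dak : delta <= a * kp / 4 by rewrite ge_min lexx orbT.
have bD2 : 0 < b * D ^+ 2 by rewrite mulr_gt0// exprn_gt0.
have esc : escape J beta D lam0 <= kp / 2.
  rewrite /escape -/b.
  have -> : lam0 ^+ 2 * (b * D ^+ 2) / (4 * (lam0 + 3)) = a * (b * D ^+ 2) by rewrite /a; ring.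
  have s2 : Num.sqrt 2 <= 2 :> R.
    rewrite -[leRHS]ger0_norm// -sqrtr_sqr ler_wsqrtr//; lra.
  have x0 : 0 < a * (b * D ^+ 2) by rewrite mulr_gt0.
  (* The crude bound [exp(-x) <= 1 / x] suffices, because [x = a b D^2] is at least [a / delta]. *)
  have h1 : expR (- (a * (b * D ^+ 2))) <= (a * (b * D ^+ 2))^-1.
    rewrite expRN lef_pV2 ?posrE ?expR_gt0//.
    by have := expR_ge1Dx (a * (b * D ^+ 2)); lra.
  have h2 : (a * (b * D ^+ 2))^-1 <= delta / a.
    by rewrite invfM mulrC ler_wpM2r ?invr_ge0 ?(ltW a_gt0)// -[leRHS]invrK lef_pV2 ?posrE ?invr_gt0.
  have h3 : delta / a <= kp / 4 by rewrite ler_pdivrMr//; lra.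
  apply: (@le_trans _ _ (2 * (kp / 4))); last lra.
  by apply: ler_pM; rewrite ?sqrtr_ge0 ?expR_ge0//; lra.
have esc1 : escape J beta D lam0 < 1 by lra.
have lnesc : - ln (1 - escape J beta D lam0) <= eps / 8.
  rewrite lerNl -[leLHS]expRK ler_ln ?posrE ?expR_gt0//; last lra.
  have : escape J beta D lam0 <= kp by lra.
  by rewrite /kp; lra.
(* For the lower bound on the free energy the mass must also satisfy [b lam1 D^2 / 2 <= eps / 8]. It
   may depend on [beta] and [D], since [L] tends to infinity last. *)
pose lam1 := Num.min lam0 (eps / 4 / (b * D ^+ 2)).
have lam1_gt0 : 0 < lam1 by rewrite lt_min lam0_gt0 !divr_gt0.
have lam1_le : lam1 <= lam0 by rewrite ge_min lexx.
have lam1_b : b * lam1 * D ^+ 2 / 2 <= eps / 8.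
  have h : lam1 <= eps / 4 / (b * D ^+ 2) by rewrite ge_min lexx orbT.
  move: h; rewrite ler_pdivlMr// => h.
  have -> : b * lam1 * D ^+ 2 / 2 = lam1 * (b * D ^+ 2) / 2 by ring.
  by lra.
have [n1 H1] := lattice_avg_near c lam0_gt0 e8.
have [n2 H2] := lattice_avg_near c lam1_gt0 e8.
apply: (@limn_esup_le _ _ _ (maxn n1 n2)) => L; rewrite geq_max => /andP[/H1[L0 h1] /H2[_ h2]].
rewrite lee_fin ler_norml.
have up := F_Delta_le L0 J0 beta0 D0 D1 c0 c2 lam0_gt0 esc1.
have lo := F_Delta_ge L0 J0 beta0 D0 D1 c0 c2 lam1_gt0 lam0_gt0 esc1.
rewrite -/b in up lo.
have s0 := near_sw c _ lam0_gt0 (lexx _); have s1 := near_sw c _ lam1_gt0 lam1_le.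
move: h1 h2 s0 s1; rewrite !ler_norml => /andP[p1 p2] /andP[p3 p4] /andP[p5 p6] /andP[p7 p8].
by apply/andP; split; lra.
Qed.
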